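(* Let $\Gamma$ be a finitely generated group with trivial amenable radical, and let $\Lambda$ be a normal subgroup of $\Gamma$ of finite index. If $\Lambda$ admits an essentially free metrizable mean-proximal action, then so does $\Gamma$.
   Context: For a countable discrete group $G$, a $G$-space is a compact space on which $G$ acts by homeomorphisms. A probability measure $\mu$ on $G$ is generating if the semigroup generated by $\{g:\mu(g)>0\}$ is $G$. A Borel probability measure $\nu$ on a $G$-space is $\mu$-stationary if $\sum_g\mu(g)\,g\nu=\nu$. With $\omega_k=g_1\cdots g_k$, $g_i$ i.i.d. of law $\mu$, a metrizable $G$-space $X$ with $\mu$-stationary $\nu$ is a $(G,\mu)$-boundary if for almost every path $\omega_k\nu$ converges weak* to a Dirac measure. A metrizable $G$-space $X$ is mean-proximal if for every generating $\mu\in\mathrm{Prob}(G)$ there is a unique $\mu$-stationary Borel probability measure $\nu_\mu$ on $X$, and $(X,\nu_\mu)$ is a $(G,\mu)$-boundary. A mean-proximal $X$ is essentially free if for every generating $\mu\in\mathrm{Prob}(G)$ and every $g\neq e$ in $G$, $\nu_\mu(\{x:gx=x\})=0$. The amenable radical is the maximal normal amenable subgroup. *)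

(* Defs.v *)
From HB Require Import structures.
From mathcomp Require Import all_boot all_order all_algebra.
From mathcomp Require Import all_classical all_reals all_analysis.

Set Implicit Arguments.
Unset Strict Implicit.
Unset Printing Implicit Defensive.

Import Order.TTheory GRing.Theory Num.Theory.
Import numFieldNormedType.Exports.

Local Open Scope classical_set_scope.
Local Open Scope ring_scope.

(* Groups are the (possibly infinite) groupType of MathComp.  A subgroup of G
   with underlying predicate S is a structure L : subGroupType S; it is a
   group in its own right. *)

Definition finitely_generated (G : groupType) : Prop :=
  exists s : seq G, forall S : {pred G},
    group_closed S -> {subset s <= S} -> forall g, g \in S.

Definition normal_in (G : groupType) (S : {pred G}) : Prop :=
  forall x g : G, x \in S -> (x ^ g)%g \in S.

Definition finite_index (G : groupType) (S : {pred G}) : Prop :=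
  finite_set [set [set (g * s)%g | s in [set` S]] | g in [set: G]].

(* Left-invariant mean, as a finitely additive probability on all subsets. *)
Definition amenable (R : realType) (G : groupType) : Prop :=
  exists m : set G -> R,
    [/\ forall A, 0 <= m A,
        m [set: G] = 1,
        forall A B, A `&` B = set0 -> m (A `|` B) = m A + m B
      & forall (g : G) A, m [set (g * a)%g | a in A] = m A].

Definition is_amenable_radical (R : realType) (G : groupType) (S : {pred G})
    (N : subGroupType S) : Prop :=
  [/\ normal_in S, amenable R N
    & forall (S' : {pred G}) (N' : subGroupType S'),
        normal_in S' -> amenable R N' -> {subset S' <= S}].

Definition trivial_amenable_radical (R : realType) (G : groupType) : Prop :=
  exists (S : {pred G}) (N : subGroupType S),
    is_amenable_radical R N /\ [set` S] = [set 1%g].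

(* Probability measures on the discrete group G, given by their masses. *)
Definition is_prob (R : realType) (G : groupType) (mu : G -> R) : Prop :=
  (forall g, 0 <= mu g) /\ (\esum_(g in [set: G]) (mu g)%:E = 1)%E.

Definition generating (R : realType) (G : groupType) (mu : G -> R) : Prop :=
  forall S : {pred G},
    mulg_closed S -> (forall g, 0 < mu g -> g \in S) -> forall g, g \in S.

Definition metrizable (R : realType) (X : topologicalType) : Prop :=
  exists d : X -> X -> R,
    [/\ forall x y, d x y = 0 <-> x = y,
        forall x y, d x y = d y x,
        forall x y z, d x z <= d x y + d y z
      & forall x, nbhs x = nbhs_ball_ (fun y e => [set z | d y z < e]) x].

(* X with its Borel sigma-algebra.  Measurable types are pointed in the library,
   hence the ptopologicalType; a space carrying a probability measure is
   nonempty anyway. *)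
Notation borel X := (g_sigma_algebraType (@open X)).

(* The inverse of act g is act g^-1, so G acts by homeomorphisms. *)
Definition is_Gspace (G : groupType) (X : ptopologicalType)
    (act : G -> X -> X) : Prop :=
  [/\ compact [set: X],
      forall x, act 1%g x = x,
      forall g h x, act (g * h)%g x = act g (act h x)
    & forall g, continuous (act g)].

Section stationary.
Variables (R : realType) (G : groupType) (X : ptopologicalType).
Variable act : G -> X -> X.

Definition translate (nu : set (borel X) -> \bar R) (g : G) :
    set (borel X) -> \bar R :=
  pushforward nu (act g : borel X -> borel X).

Definition stationary (mu : G -> R) (nu : probability (borel X) R) : Prop :=
  forall A : set (borel X), measurable A ->
    (\esum_(g in [set: G]) ((mu g)%:E * translate nu g A) = nu A)%E.

Definition weak_star_cvg (m : nat -> set (borel X) -> \bar R)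
    (l : set (borel X) -> \bar R) : Prop :=
  forall f : X -> R, continuous f ->
    (\int[m k]_(x in [set: borel X]) (f x)%:E)%E @[k --> \oo] -->
    (\int[l]_(x in [set: borel X]) (f x)%:E)%E.

Definition iid_of_law (mu : G -> R) d (W : measurableType d)
    (P : probability W R) (g : nat -> W -> G) : Prop :=
  [/\ forall i (A : set G), measurable (g i @^-1` A),
      forall i x, P (g i @^-1` [set x]) = (mu x)%:E
    & forall n (A : nat -> set G),
        (P (\bigcap_(i in [set i | (i < n)%N]) (g i @^-1` A i)) =
         \prod_(i < n) P (g i @^-1` A i))%E].

Definition walk (W : Type) (g : nat -> W -> G) (k : nat) (w : W) : G :=
  (\prod_(i < k) g i w)%g.

(* The convergence along almost every path only depends on the law of the
   increments, so they may live on any probability space. *)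
Definition is_boundary (mu : G -> R) (nu : probability (borel X) R) : Prop :=
  forall d (W : measurableType d) (P : probability W R) (g : nat -> W -> G),
    iid_of_law mu P g ->
    {ae P, forall w, exists x : borel X,
       weak_star_cvg (fun k => translate nu (walk g k w)) \d_x}.

Definition mean_proximal : Prop :=
  [/\ is_Gspace act, metrizable R X
    & forall mu : G -> R, is_prob mu -> generating mu ->
        exists nu : probability (borel X) R,
          [/\ stationary mu nu,
              forall nu' : probability (borel X) R, stationary mu nu' ->
                forall A : set (borel X), measurable A -> nu' A = nu A
            & is_boundary mu nu]].

(* For a mean-proximal action, nu below is the unique stationary measure. *)
Definition essentially_free : Prop :=
  forall mu : G -> R, is_prob mu -> generating mu ->
    forall nu : probability (borel X) R, stationary mu nu ->
      forall g : G, g <> 1%g -> nu [set x | act g x = x] = 0%E.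

End stationary.

Definition has_ess_free_mean_proximal_action (R : realType) (G : groupType) :
    Prop :=
  exists (X : ptopologicalType) (act : G -> X -> X),
    mean_proximal R act /\ essentially_free R act.

(* Main.v *)
(* Gamma acts on X^(Gamma/Lambda) by the action induced from Lambda acting on X;
   Lambda itself acts on the factors by twists of the given action by the
   conjugations by coset representatives.

   Given a stationary measure nu, let V g = min_p of the integral of
   d (g x, p) d nu(x): it vanishes iff g nu is a Dirac mass, and it is
   superharmonic.  If the averages of V along the walk tend to 0, a maximal
   inequality shows that nu is a boundary; comparing Lipschitz integrals shows
   that nu is determined by its costs.  For the walk on Lambda these averages
   tend to 0 on X^n because all the coordinates contract, each to its own
   boundary point.

   The first return of the walk on Gamma to Lambda has a generating law mu_L;
   the expected return time is at most the index.  Stationary measures restrict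
   from mu to mu_L and extend from mu_L to mu, and bounded mu-harmonic functions
   are mu_L-harmonic on Lambda.  The limit of the averages of V for mu is
   harmonic and dominated by V, hence it vanishes at 1 by contraction along mu_L.

   If g <> 1 fixed a set of positive measure, then h |-> nu (Fix h) on the
   conjugacy class of g would be harmonic, with sum at most 1 over each coset of
   Lambda by freeness of Lambda; the maximum principle makes the class finite,
   and since g is torsion Dietzmann's lemma puts it in a finite normal subgroup,
   which the triviality of the amenable radical excludes. *)
Require Import Defs.
From HB Require Import structures.
From mathcomp Require Import all_boot all_order all_algebra.
From mathcomp Require Import all_classical all_reals all_analysis.
From mathcomp Require Import measurable_realfun.
From mathcomp Require Import ring lra.

Set Implicit Arguments.
Unset Strict Implicit.
Unset Printing Implicit Defensive.

Import Order.TTheory GRing.Theory Num.Theory.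
Import numFieldNormedType.Exports.

Local Open Scope classical_set_scope.
Local Open Scope ring_scope.

(** The obstacle is that the hypothesis speaks only of laws on Lambda. Each coset coordinate sees
    its own conjugate of the return law, so the hypothesis is applied to one generating law per
    coordinate; the boundary points so obtained are coupled through common increments, and a
    stationary measure on the product is not visibly determined by its marginals. This is why the
    argument runs through costs: with the sum metric on the product a cost depends on the marginals
    alone, and contraction then upgrades equality of costs to equality of measures. Costs also
    replace martingale convergence of measures: for a fixed point p the cost is a nonnegative
    harmonic function of g, so a maximal inequality controls whole paths. Existence of a stationary
    measure for Gamma comes from an explicit occupation measure instead of a fixed point theorem.
    The minimal cost V itself is not harmonic; the limit of its averages is, so it can be evaluated
    along the return law, where contraction is known. *)

Section esum_extra.
Local Open Scope ereal_scope.
Context {R : realType}.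

Lemma esumZl (T : choiceType) (D : set T) (a : T -> \bar R) (c : R) :
  (0 <= c)%R -> (forall i, 0 <= a i) ->
  \esum_(i in D) (c%:E * a i) = c%:E * \esum_(i in D) a i.
Proof.
move=> c0 a0; rewrite /esum -ereal_supZl//; last first.
  by apply/set0P; exists (\sum_(i \in set0) a i), set0 => //; exact: fsets_set0.
congr ereal_sup; apply/seteqP; split => [_ [X [fX XD] <-]|_ [_ [X [fX XD] <-] <-]].
  by exists (\sum_(i \in X) a i); [exists X|rewrite ge0_mule_fsumr].
by exists X => //; rewrite ge0_mule_fsumr.
Qed.

Lemma esumZr (T : choiceType) (D : set T) (a : T -> \bar R) (c : R) :
  (0 <= c)%R -> (forall i, 0 <= a i) ->
  \esum_(i in D) (a i * c%:E) = (\esum_(i in D) a i) * c%:E.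
Proof.
by move=> c0 a0; rewrite muleC -esumZl//; apply: eq_esum => i _; rewrite muleC.
Qed.

Lemma exchange_esum (T1 T2 : choiceType) (D1 : set T1) (D2 : set T2)
    (a : T1 -> T2 -> \bar R) : (forall i j, 0 <= a i j) ->
  \esum_(i in D1) \esum_(j in D2) a i j = \esum_(j in D2) \esum_(i in D1) a i j.
Proof.
move=> a0; rewrite !esum_esum//.
rewrite (reindex_esum (D2 `*` D1) _ (fun x => (x.2, x.1)))//; split=> //=.
- by move=> [i j] [].
- by move=> [i j] [k l] _ _ /= [-> ->].
- by move=> [i j] [/= D1i D2j]; exists (j, i).
Qed.

Lemma le_esum_subset (T : choiceType) (D E : set T) (a : T -> \bar R) :
  D `<=` E -> \esum_(i in D) a i <= \esum_(i in E) a i.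
Proof.
move=> DE; apply: ge_ereal_sup => /= _ [X [fX XD] <-].
by apply: esum_ge; exists X => //; split=> // x /XD/DE.
Qed.

(** Finite and infinite types are treated alike: [D] cuts out the indices at which the total
    function [e] enumerates [T], so a sum over [T] becomes a series over [nat] padded with zeros. *)
Lemma enum_countable (T : choiceType) (t0 : T) : countable [set: T] ->
  exists (e : nat -> T) (D : pred nat), set_bij [set n | D n] [set: T] e.
Proof.
move=> /countable_injP[f /= finj].
have inj x y : f x = f y -> x = y by move=> fxy; apply: finj; rewrite ?inE.
exists (fun n => if pselect (exists t, f t = n) is left h
                 then projT1 (cid h) else t0).
exists (fun n => `[< exists t, f t = n >]); split => //=.
- move=> n m; rewrite !inE/= => /asboolP hn /asboolP hm.
  case: pselect => // hn'; case: pselect => // hm'.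
  case: cid => x /= <-; case: cid => y /= <- -> //.
- move=> t _; exists (f t); first by apply/asboolP; exists t.
  case: pselect => [h|[]]; last by exists t.
  by case: cid => /= x /inj.
Qed.

Section enumerated.
Variables (T : choiceType) (e : nat -> T) (D : pred nat).
Hypothesis eD : set_bij [set n | D n] [set: T] e.

Lemma esum_enum (a : T -> \bar R) : (forall t, 0 <= a t) ->
  \esum_(t in [set: T]) a t = \sum_(n <oo) (if D n then a (e n) else 0).
Proof.
move=> a0; rewrite (reindex_esum _ _ _ _ eD).
by rewrite -nneseries_esum// eseries_mkcond.
Qed.

Lemma bigcup_enum (U : Type) (F : T -> set U) :
  \bigcup_t F t = \bigcup_n (if D n then F (e n) else set0).
Proof.
apply/seteqP; split=> x.
  move=> [t _ Ft]; have [_ _ /(_ t I)[n /= Dn nt]] := eD.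
  by exists n => //; rewrite Dn nt.
by move=> [n _]; case: ifP => // Dn Fn; exists (e n).
Qed.

Lemma trivIset_enum (U : Type) (F : T -> set U) : trivIset [set: T] F ->
  trivIset [set: nat] (fun n => if D n then F (e n) else set0).
Proof.
move=> /trivIsetP tF; apply/trivIsetP => i j _ _ ij.
case: ifPn => Di; last by rewrite set0I.
case: ifPn => Dj; last by rewrite setI0.
apply: tF => //; apply: contra_neq ij.
by have [_ inj _] := eD; apply: inj; rewrite inE.
Qed.

End enumerated.
End esum_extra.

(** * Countable partitions and mixtures of measures *)

Section countable_measure.
Local Open Scope ereal_scope.
Context {R : realType} d (W : measurableType d).

Lemma countable_bigcup_measurable (T : choiceType) (F : T -> set W) :
  countable [set: T] -> (forall t, measurable (F t)) ->
  measurable (\bigcup_t F t).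
Proof.
move=> cT mF; exact: countable_bigcupT_measurable.
Qed.

Lemma ge0_integral_partition (mu : {measure set W -> \bar R}) (T : choiceType)
    (F : T -> set W) (f : W -> \bar R) :
  countable [set: T] -> (forall t, measurable (F t)) ->
  trivIset [set: T] F -> measurable_fun (\bigcup_t F t) f ->
  (forall x, 0 <= f x) ->
  \int[mu]_(x in \bigcup_t F t) f x =
  \esum_(t in [set: T]) \int[mu]_(x in F t) f x.
Proof.
move=> cT mF tF mf f0.
have [[t0]|nT] := pselect (inhabited T); last first.
  rewrite (_ : \bigcup_t F t = set0); last first.
    by apply/seteqP; split => x // [t]; exfalso; apply: nT.
  rewrite (_ : [set: T] = set0); last first.
    by apply/seteqP; split => t // _; apply: nT.
  by rewrite integral_set0 esum_set0.
have [e [D eD]] := enum_countable t0 cT.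
rewrite (esum_enum eD); last by move=> t; exact: integral_ge0.
move: mf; rewrite (bigcup_enum eD) => mf.
rewrite ge0_integral_bigcup//.
- by apply: eq_eseriesr => n _; case: ifP => // _; rewrite integral_set0.
- by move=> n; case: ifP.
- exact: trivIset_enum.
Qed.

Lemma measure_partition (mu : {measure set W -> \bar R}) (T : choiceType)
    (F : T -> set W) :
  countable [set: T] -> (forall t, measurable (F t)) ->
  trivIset [set: T] F ->
  mu (\bigcup_t F t) = \esum_(t in [set: T]) mu (F t).
Proof.
move=> cT mF tF.
have mU := countable_bigcup_measurable cT mF.
have := @ge0_integral_partition mu T F (cst 1) cT mF tF.
rewrite integral_cst// mul1e => ->//.
by apply: eq_esum => t _; rewrite integral_cst// mul1e.
Qed.

(** Serves both for the convolution of a law on the group with a measure and for the occupation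
    measure of excursions; the total mass of the latter is not 1, so the weights are not
    normalised. *)
Lemma mixture (T : choiceType) (t0 : T) (a : T -> R) (m : T -> {measure set W -> \bar R}) :
  countable [set: T] -> (forall t, 0 <= a t)%R ->
  exists nu : {measure set W -> \bar R},
    (forall A, nu A = \esum_(t in [set: T]) ((a t)%:E * m t A)) /\
    (forall f : W -> \bar R, measurable_fun setT f -> (forall x, 0 <= f x) ->
      \int[nu]_x f x = \esum_(t in [set: T]) ((a t)%:E * \int[m t]_x f x)).
Proof.
move=> cT a0.
have [e [D eD]] := enum_countable t0 cT.
pose b n : {nonneg R} := if D n then NngNum (a0 (e n)) else NngNum (lexx 0%R).
pose m_ (n : nat) : {measure set W -> \bar R} := mscale (b n) (m (e n)).
exists (mseries m_ 0); split.
  move=> A; rewrite (esum_enum eD); last by move=> t; rewrite mule_ge0// lee_fin.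
  apply: eq_eseriesr => n _; rewrite /m_ /b /mscale/=; case: ifP => // _.
  by rewrite /mscale/= mul0e.
move=> f mf f0; rewrite ge0_integral_measure_series//.
rewrite (esum_enum eD); last first.
  by move=> t; rewrite mule_ge0// ?lee_fin// integral_ge0.
apply: eq_eseriesr => n _; rewrite ge0_integral_mscale// /b.
by case: ifP => // _; rewrite mul0e.
Qed.

End countable_measure.

(** * Random walks *)

Section walk_operator.
Local Open Scope ereal_scope.
Context {R : realType} {G : groupType}.
Implicit Types (mu : G -> R) (u v : G -> \bar R).

(** The Markov operator of the walk with steps multiplied on the right; its fixed functions are the
    harmonic ones. Extended real values spare summability conditions on nonnegative functions. *)
Definition avg mu u (g : G) : \bar R :=
  \esum_(s in [set: G]) ((mu s)%:E * u (g * s)%g).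

Section prob.
Variable mu : G -> R.
Hypothesis hmu : is_prob mu.

Let mu0 s : 0 <= (mu s)%:E. Proof. by rewrite lee_fin; apply hmu.1. Qed.

Lemma avg_ge0 u g : (forall h, 0 <= u h) -> 0 <= avg mu u g.
Proof. by move=> u0; apply: esum_ge0 => s _; exact: mule_ge0. Qed.

Lemma le_avg u v g : (forall h, 0 <= u h) -> (forall h, u h <= v h) ->
  avg mu u g <= avg mu v g.
Proof. by move=> u0 uv; apply: le_esum => s _; exact: lee_wpmul2l. Qed.

Lemma avg_cst (c : \bar R) g : 0 <= c -> avg mu (cst c) g = c.
Proof.
move=> c0; rewrite /avg /=.
case: c c0 => [c||//] c0; first by rewrite esumZr// hmu.2 mul1e.
apply/eqP; rewrite -leye_eq.
have [s mus] : exists s, (0 < mu s)%R.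
  apply: contrapT => /forallNP mu_le0.
  have := hmu.2; rewrite esum1; first by move=> [] /esym/eqP; rewrite oner_eq0.
  by move=> s _; congr EFin; apply/eqP; rewrite eq_le hmu.1 andbT leNgt; apply/negP.
apply: esum_ge; exists [set s]; first by split.
by rewrite fsbig_set1 gt0_muley// lte_fin.
Qed.

Lemma avgD u v g : (forall h, 0 <= u h) -> (forall h, 0 <= v h) ->
  avg mu (fun h => u h + v h) g = avg mu u g + avg mu v g.
Proof.
move=> u0 v0; rewrite /avg -esumD; try by move=> *; exact: mule_ge0.
by apply: eq_esum => s _; rewrite ge0_muleDr.
Qed.

Lemma avgZ (c : R) u g : (0 <= c)%R -> (forall h, 0 <= u h) ->
  avg mu (fun h => c%:E * u h) g = c%:E * avg mu u g.
Proof.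
move=> c0 u0; rewrite /avg -esumZl//; last by move=> s; exact: mule_ge0.
by apply: eq_esum => s _; rewrite muleCA.
Qed.

Lemma iter_avg_ge0 k u g : (forall h, 0 <= u h) -> 0 <= iter k (avg mu) u g.
Proof. by move=> u0; elim: k g => //= k ih g; exact: avg_ge0. Qed.

Lemma le_iter_avg k u v g : (forall h, 0 <= u h) -> (forall h, u h <= v h) ->
  iter k (avg mu) u g <= iter k (avg mu) v g.
Proof.
move=> u0 uv; elim: k g => //= k ih g.
by apply: le_avg => // h; exact: iter_avg_ge0.
Qed.

Lemma iter_avg_cst k (c : \bar R) g : 0 <= c -> iter k (avg mu) (cst c) g = c.
Proof.
move=> c0; elim: k g => //= k ih g.
by rewrite (_ : iter _ _ _ = cst c) ?avg_cst//; apply/funext.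
Qed.

Lemma iter_avgD k u v g : (forall h, 0 <= u h) -> (forall h, 0 <= v h) ->
  iter k (avg mu) (fun h => u h + v h) g =
  iter k (avg mu) u g + iter k (avg mu) v g.
Proof.
move=> u0 v0; elim: k g => //= k ih g; rewrite -avgD//.
- by congr avg; apply/funext.
- by move=> h; exact: iter_avg_ge0.
- by move=> h; exact: iter_avg_ge0.
Qed.

Lemma iter_avgZ k (c : R) u g : (0 <= c)%R -> (forall h, 0 <= u h) ->
  iter k (avg mu) (fun h => c%:E * u h) g = c%:E * iter k (avg mu) u g.
Proof.
move=> c0 u0; elim: k g => //= k ih g; rewrite -avgZ//.
- by congr avg; apply/funext.
- by move=> h; exact: iter_avg_ge0.
Qed.

Lemma iter_avg_harmonic k u : avg mu u = u -> iter k (avg mu) u = u.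
Proof. by move=> uE; elim: k => //= k ->. Qed.

End prob.
End walk_operator.


Section cylinders.
Local Open Scope ereal_scope.
Context {R : realType} {G : groupType} (mu : G -> R) (hmu : is_prob mu).
Context d (W : measurableType d) (P : probability W R) (g : nat -> W -> G).
Hypothesis cG : countable [set: G].
Hypothesis giid : iid_of_law mu P g.

Definition cylinder (a : seq G) : set W :=
  [set w | forall i, (i < size a)%N -> g i w = nth 1%g a i].

Definition weight (a : seq G) : R := (\prod_(x <- a) mu x)%R.

Lemma weight_rcons a s : weight (rcons a s) = (weight a * mu s)%R.
Proof. by rewrite /weight big_rcons. Qed.

Lemma weight_ge0 a : (0 <= weight a)%R.
Proof. by apply: prodr_ge0 => x _; apply hmu.1. Qed.

Lemma cylinder_nil : cylinder [::] = setT.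
Proof. by apply/seteqP. Qed.

Lemma cylinder_rconsE a s :
  cylinder (rcons a s) = cylinder a `&` g (size a) @^-1` [set s].
Proof.
apply/seteqP; split=> [w|w [aw /= gw]].
  rewrite /cylinder/= => aw; split; last first.
    by rewrite (aw (size a)) ?size_rcons// nth_rcons ltnn eqxx.
  by move=> i ia; rewrite aw ?size_rcons ?ltnS 1?ltnW// nth_rcons ia.
move=> i; rewrite size_rcons ltnS leq_eqVlt nth_rcons => /predU1P[->|ia].
  by rewrite ltnn eqxx.
by rewrite ia aw.
Qed.

Lemma cylinderE a : cylinder a =
  \bigcap_(i in [set i | (i < size a)%N]) (g i @^-1` [set nth 1%g a i]).
Proof. by []. Qed.

Lemma measurable_cylinder a : measurable (cylinder a).
Proof.
elim/last_ind: a => [|a s ih]; first by rewrite cylinder_nil.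
by rewrite cylinder_rconsE; apply: measurableI => //; case: giid.
Qed.

Lemma prob_cylinder a : P (cylinder a) = (weight a)%:E.
Proof.
have [_ g1 gI] := giid.
rewrite cylinderE gI; under eq_bigr do rewrite g1.
rewrite /weight (big_nth 1%g) big_mkord.
by elim/big_rec2: _ => // i x y _ ->.
Qed.

Lemma cylinder_rcons_bigcup a : \bigcup_s cylinder (rcons a s) = cylinder a.
Proof.
apply/seteqP; split=> [w [s _]|w aw].
  by rewrite cylinder_rconsE => -[].
by exists (g (size a) w) => //; rewrite cylinder_rconsE.
Qed.

Lemma cylinder_rcons_trivIset a :
  trivIset [set: G] (fun s => cylinder (rcons a s)).
Proof.
apply/trivIsetP => s t _ _ /eqP st; apply/seteqP; split => // w.
rewrite !cylinder_rconsE => -[[_ /= gs] [_ /= gt]].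
by apply: st; rewrite -gs -gt.
Qed.

Lemma walkS k w : walk g k.+1 w = (walk g k w * g k w)%g.
Proof. by rewrite /walk big_ord_recr. Qed.

Lemma walk0 w : walk g 0 w = 1%g.
Proof. by rewrite /walk big_ord0. Qed.

Definition wprod (a : seq G) : G := (\prod_(x <- a) x)%g.

Lemma wprod_rcons a s : wprod (rcons a s) = (wprod a * s)%g.
Proof. by rewrite /wprod -cats1 big_cat big_seq1. Qed.

Lemma cylinder_walk a w : cylinder a w -> walk g (size a) w = wprod a.
Proof.
elim/last_ind: a => [|a s ih]; first by rewrite walk0 /wprod big_nil.
rewrite cylinder_rconsE => -[/ih aw /= gs].
by rewrite size_rcons walkS aw gs wprod_rcons.
Qed.

Lemma walk_preimage k (A : set G) : measurable (walk g k @^-1` A).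
Proof.
elim: k A => [|k ih] A.
  rewrite (_ : _ @^-1` _ = if pselect (A 1%g) then setT else set0); last first.
    by apply/seteqP; split=> w /=; rewrite walk0; case: pselect.
  by case: pselect => _ /=; [exact: measurableT|exact: measurable0].
rewrite (_ : _ @^-1` _ =
  \bigcup_s (walk g k @^-1` [set h | A (h * s)%g] `&` g k @^-1` [set s])).
  apply: countable_bigcup_measurable => // s; apply: measurableI => //.
  by case: giid.
apply/seteqP; split=> [w /=|w [s _ [/= As gs]]].
  by rewrite walkS => Aw; exists (g k w).
by rewrite walkS gs.
Qed.

Lemma walk2_preimage j k (A : G -> G -> Prop) :
  measurable [set w | A (walk g j w) (walk g k w)].
Proof.
rewrite (_ : [set w | _] =
  \bigcup_s (walk g j @^-1` [set s] `&` walk g k @^-1` (A s))).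
  apply: countable_bigcup_measurable => // s.
  by apply: measurableI; exact: walk_preimage.
apply/seteqP; split=> [w /= Aw|w [s _ [/= <- //]]].
by exists (walk g j w).
Qed.

Lemma measurable_walk k (u : G -> \bar R) : measurable_fun setT (fun w => u (walk g k w)).
Proof.
by move=> _ A mA; rewrite setTI; exact: (walk_preimage k (u @^-1` A)).
Qed.

(** The Markov property: splitting a cylinder according to its next letter takes the place of
    conditional expectation. *)
Lemma integral_cylinder_walk k a (u : G -> \bar R) : (forall h, 0 <= u h) ->
  \int[P]_(w in cylinder a) u (walk g (size a + k) w) =
  (weight a)%:E * iter k (avg mu) u (wprod a).
Proof.
move=> u0; elim: k a => [|k ih] a.
  rewrite addn0 (eq_integral (cst (u (wprod a)))); last first.
    by move=> w /[!inE] /cylinder_walk ->.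
  rewrite integral_cst/=; last exact: measurable_cylinder.
  by rewrite prob_cylinder muleC.
rewrite -cylinder_rcons_bigcup ge0_integral_partition//; last 3 first.
- by move=> s; exact: measurable_cylinder.
- exact: cylinder_rcons_trivIset.
- by apply: measurable_funTS; exact: measurable_walk.
rewrite /= /avg -esumZl ?weight_ge0//; last first.
  by move=> s; rewrite mule_ge0 ?iter_avg_ge0// lee_fin; apply hmu.1.
apply: eq_esum => s _.
rewrite addnS -addSn -(size_rcons a s) ih weight_rcons wprod_rcons EFinM.
by rewrite muleA.
Qed.

Lemma integral_walk k (u : G -> \bar R) : (forall h, 0 <= u h) ->
  \int[P]_w u (walk g k w) = iter k (avg mu) u 1%g.
Proof.
move=> u0; have := integral_cylinder_walk k [::] u0.
by rewrite cylinder_nil add0n /weight big_nil mul1e /wprod big_nil.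
Qed.

(** Doob's maximal inequality, by induction on the horizon. Either [u] has already reached [e] at
    the end of [a], and the whole cylinder is charged, or the cylinder splits by the next letter and
    superharmonicity sums up the bounds. *)
Lemma maximal_ineq n a (u : G -> \bar R) (e : R) : (0 < e)%R ->
  (forall h, 0 <= u h) -> (forall h, avg mu u h <= u h) ->
  e%:E * P (cylinder a `&`
    [set w | exists2 j, (j <= n)%N & e%:E <= u (walk g (size a + j) w)]) <=
  (weight a)%:E * u (wprod a).
Proof.
move=> e0 u0 hu.
have mE a' n' : measurable [set w | exists2 j, (j <= n')%N &
    e%:E <= u (walk g (size a' + j) w)].
  rewrite (_ : [set w | _] = \bigcup_(j in [set j | (j <= n')%N])
      (walk g (size a' + j) @^-1` [set h | e%:E <= u h])); last first.
    by apply/seteqP; split=> w [j]; exists j.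
  by apply: bigcup_measurable => j _; exact: walk_preimage.
elim: n a => [|n ih] a; have [ea|ea] := leP e%:E (u (wprod a)).
- rewrite muleC lee_pmul//; first exact: ltW.
  rewrite -prob_cylinder; apply: le_measure; rewrite ?inE//.
    by apply: measurableI; [exact: measurable_cylinder|exact: mE].
  exact: measurable_cylinder.
- rewrite (_ : _ `&` _ = set0) ?measure0 ?mule0 ?mule_ge0 ?lee_fin ?weight_ge0//.
  apply/seteqP; split => // w [/cylinder_walk wa [[|//] _]].
  by rewrite addn0 wa leNgt ea.
- rewrite muleC lee_pmul//; first exact: ltW.
  rewrite -prob_cylinder; apply: le_measure; rewrite ?inE//.
    by apply: measurableI; [exact: measurable_cylinder|exact: mE].
  exact: measurable_cylinder.
rewrite (_ : _ `&` _ = \bigcup_s (cylinder (rcons a s) `&`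
  [set w | exists2 j, (j <= n)%N & e%:E <= u (walk g (size (rcons a s) + j) w)])).
  rewrite measure_partition//; last 2 first.
  - by move=> s; apply: measurableI; [exact: measurable_cylinder|exact: mE].
  - have /trivIsetP tc := cylinder_rcons_trivIset (a := a).
    by apply/trivIsetP => s t _ _ st; rewrite setIACA tc// set0I.
  rewrite -esumZl//; last exact: ltW.
  apply: (@le_trans _ _ ((weight a)%:E * avg mu u (wprod a))); last first.
    by rewrite lee_wpmul2l// lee_fin weight_ge0.
  rewrite /avg -esumZl ?weight_ge0//; last first.
    by move=> s; rewrite mule_ge0// lee_fin; apply hmu.1.
  apply: le_esum => s _; apply: le_trans (ih _) _.
  by rewrite weight_rcons wprod_rcons EFinM muleA.
apply/seteqP; split=> [w [aw [[|j]]]|w [s _ []]].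
- by rewrite addn0 (cylinder_walk aw) leNgt ea.
- move=> jn ej; exists (g (size a) w) => //; split.
    by rewrite cylinder_rconsE.
  by exists j => //; rewrite size_rcons addSn -addnS.
- rewrite cylinder_rconsE => -[aw _] [j jn ej]; split => //.
  by exists j.+1 => //; rewrite addnS -addSn -(size_rcons a s).
Qed.

End cylinders.

(* If [D] has law [mu] and is independent of the measure-preserving map [T],
   then the digits D, D \o T, D \o T \o T, ... are i.i.d. *)
Section bernoulli_shift.
Local Open Scope ereal_scope.
Context {R : realType} {G : groupType} (mu : G -> R) (hmu : is_prob mu).
Hypothesis cG : countable [set: G].
Context d (W : measurableType d) (P : probability W R) (D : W -> G) (T : W -> W).
Hypothesis mD : forall A : set G, measurable (D @^-1` A).
Hypothesis mT : forall B, measurable B -> measurable (T @^-1` B).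
Hypothesis PDT : forall s B, measurable B ->
  P (D @^-1` [set s] `&` T @^-1` B) = (mu s)%:E * P B.

Let prob_digits (A : set G) B : measurable B ->
  P (D @^-1` A `&` T @^-1` B) = (\esum_(s in A) (mu s)%:E) * P B.
Proof.
move=> mB.
rewrite (_ : _ `&` _ = \bigcup_s (if s \in A then
    D @^-1` [set s] `&` T @^-1` B else set0)); last first.
  apply/seteqP; split=> [w [/= Dw Tw]|w [s _]].
    by exists (D w) => //; rewrite mem_set.
  by case: ifPn => // /set_mem As [/= -> ?].
rewrite measure_partition//; last 2 first.
- by move=> s; case: ifP => // _; apply: measurableI => //; exact: mT.
- apply/trivIsetP => s t _ _ st; apply/seteqP; split => // w [].
  case: ifP => // _ [/= Ds _]; case: ifP => // _ [/= Dt _].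
  by move: st; rewrite -Ds -Dt eqxx.
rewrite -(fineK (fin_num_measure P _ mB)) -esumZr ?fine_ge0//; last first.
  by move=> s; rewrite lee_fin; apply hmu.1.
rewrite [RHS]esum_mkcond; apply: eq_esum => s _.
by case: ifP => _; rewrite /= ?measure0// PDT// fineK// fin_num_measure.
Qed.

Lemma bernoulli_iid : iid_of_law mu P (fun i w => D (iter i T w)).
Proof.
have mg i (A : set G) : measurable ((fun w => D (iter i T w)) @^-1` A).
  elim: i => [|i ih]; first exact: mD.
  have := mT ih; congr measurable; apply/seteqP.
  by split=> w /=; rewrite -iterSr.
have PT B : measurable B -> P (T @^-1` B) = P B.
  move=> mB; have := @prob_digits setT B mB.
  by rewrite preimage_setT setTI hmu.2 mul1e.
have PD A : P (D @^-1` A) = \esum_(s in A) (mu s)%:E.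
  have := @prob_digits A setT measurableT.
  by rewrite preimage_setT setIT probability_setT mule1.
have Pg i (A : set G) : P ((fun w => D (iter i T w)) @^-1` A) = P (D @^-1` A).
  elim: i => // i ih; rewrite -ih -(PT _ (mg i A)); congr (P _).
  by apply/seteqP; split=> w /=; rewrite -iterSr.
split=> //.
  by move=> i x; rewrite Pg PD esum_set1// lee_fin; apply hmu.1.
elim=> [|n ih] A.
  rewrite big_ord0 (_ : \bigcap_(_ in _) _ = setT) ?probability_setT//.
  by apply/seteqP.
rewrite big_ord_recl Pg.
under eq_bigr => i _ do rewrite Pg -(Pg i).
rewrite -(ih (fun i => A i.+1)).
rewrite PD -prob_digits; last first.
  by apply: bigcap_measurableType => i _; exact: mg.
congr (P _); apply/seteqP; split=> [w /= Aw|w [/= Aw0 Aw] [|i] /= ni//].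
  split; first exact: (Aw 0%N).
  by move=> i /= ni; rewrite -iterSr; exact: (Aw i.+1).
by rewrite -iterS iterSr; exact: Aw.
Qed.

End bernoulli_shift.

(** * Affine images of Lebesgue measure and existence of i.i.d. increments *)

Section image_measure.
Context d d' {T : measurableType d} {T' : measurableType d'} {R : realType}.
Variables (m : {measure set T -> \bar R}) (f : {mfun T >-> T'}).

Definition image_measure : set T' -> \bar R := pushforward m f.

Let image_measure0 : image_measure set0 = 0%E.
Proof. exact: measure0. Qed.

Let image_measure_ge0 A : (0 <= image_measure A)%E.
Proof. exact: measure_ge0. Qed.

Let image_measure_sigma_additive : semi_sigma_additive image_measure.
Proof. exact: measure_semi_sigma_additive. Qed.

HB.instance Definition _ := isMeasure.Build _ _ _ image_measure
  image_measure0 image_measure_ge0 image_measure_sigma_additive.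

End image_measure.

Section total_mass_one.
Context d {T : measurableType d} {R : realType}.
Variables (m : {measure set T -> \bar R}) (m1 : m setT = 1%E).

(** The proof of total mass one is an argument, so that the term itself determines its probability
    structure. *)
Definition unit_measure of m setT = 1%E : set T -> \bar R := m.

Let unit_measure0 : unit_measure m1 set0 = 0%E.
Proof. exact: measure0. Qed.

Let unit_measure_ge0 A : (0 <= unit_measure m1 A)%E.
Proof. exact: measure_ge0. Qed.

Let unit_measure_sigma_additive : semi_sigma_additive (unit_measure m1).
Proof. exact: measure_semi_sigma_additive. Qed.

HB.instance Definition _ := isMeasure.Build _ _ _ (unit_measure m1)
  unit_measure0 unit_measure_ge0 unit_measure_sigma_additive.

HB.instance Definition _ :=
  Measure_isProbability.Build _ _ _ (unit_measure m1) m1.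

Definition mk_probability : probability T R := unit_measure m1.

Lemma mk_probabilityE A : mk_probability A = m A. Proof. by []. Qed.

End total_mass_one.

Section unit_interval.
Context {R : realType}.
Local Notation RR := (measurableTypeR R).
Local Notation leb := (@lebesgue_measure R).
Local Open Scope ereal_scope.

(** The rescaled image of Lebesgue measure gives half-open intervals their length, hence is Lebesgue
    measure by uniqueness. *)
Lemma lebesgue_affine (c p : R) (B : set RR) : (0 < p)%R -> measurable B ->
  leb ((fun x : R => (x - c) / p)%R @^-1` B) = p%:E * leb B.
Proof.
move=> p0 mB.
have mf : measurable_fun setT ((fun x : R => (x - c) / p)%R : RR -> RR).
  apply: continuous_measurable_fun => x.
  by apply: cvgM; [apply: cvgB; [exact: cvg_id|exact: cvg_cst]|exact: cvg_cst].
have pV0 : (0 <= p^-1)%R by rewrite invr_ge0 ltW.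
suff : leb B = p^-1%:E * leb ((fun x : R => (x - c) / p)%R @^-1` B).
  by move=> ->; rewrite muleA -EFinM divff ?gt_eqF// mul1e.
pose f_ : {mfun RR >-> RR} := HB.pack (fun x : R => (x - c) / p)%R
  (isMeasurableFun.Build _ _ _ _ _ mf).
pose m : {measure set RR -> \bar R} := mscale (NngNum pV0) (image_measure leb f_).
suff -> : leb B = m B by []. apply: (@lebesgue_measure_unique R m) => // X [[a b] _ <-]/=.
rewrite /mscale/= /pushforward/=.
have -> : (fun x : R => (x - c) / p)%R @^-1` `]a, b]%classic =
    `](c + p * a)%R, (c + p * b)%R]%classic.
  apply/seteqP; split=> x /=; rewrite !in_itv/=.
    by rewrite ltr_pdivlMr// ler_pdivrMr// => /andP[]; rewrite !(mulrC p); lra.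
  by rewrite ltr_pdivlMr// ler_pdivrMr// => /andP[]; rewrite !(mulrC p); lra.
rewrite !lebesgue_measure_itv/= !lte_fin ltrD2l ltr_pM2l//.
case: ifPn => // _; last by rewrite mule0.
by rewrite -!EFinD -EFinM; congr EFin; field; rewrite gt_eqF.
Qed.
End unit_interval.

Section iid_existence.
Context {R : realType} {G : groupType} (mu : G -> R) (hmu : is_prob mu).
Hypothesis cG : countable [set: G].
Local Notation RR := (measurableTypeR R).
Local Notation leb := (@lebesgue_measure R).

(* The base-mu digit expansion of a Lebesgue random point of [0, 1): the unit
   interval is cut into consecutive intervals of lengths mu s, the digit of x
   is the s whose interval contains x, and the shift rescales that interval to
   [0, 1). *)
Lemma exists_iid : exists (P : probability RR R) (g : nat -> RR -> G),
  iid_of_law mu P g.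
Proof.
have [e [Dm eD]] := enum_countable (1%g : G) cG.
pose p n := if Dm n then mu (e n) else 0.
have p0 n : 0 <= p n by rewrite /p; case: ifP => // _; apply hmu.1.
pose c n := \sum_(0 <= m < n) p m.
have cS n : c n.+1 = c n + p n by rewrite /c big_nat_recr.
have c_le m n : (m <= n)%N -> c m <= c n.
  move=> mn; rewrite /c [leRHS](big_cat_nat (leq0n m) mn)/= lerDl.
  exact: sumr_ge0.
have c0 : c 0%N = 0 by rewrite /c big_geq.
have pE : (\sum_(n <oo) (p n)%:E = 1)%E.
  rewrite -hmu.2 (esum_enum eD); last by move=> t; rewrite lee_fin; apply hmu.1.
  by apply: eq_eseriesr => n _; rewrite /p; case: ifP.
have c_lt1 x : x < 1 -> exists n, x < c n.
  move=> x1; apply: contrapT => /forallNP cx.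
  have : (\sum_(n <oo) (p n)%:E <= x%:E)%E.
    apply: lime_le; first by apply: is_cvg_nneseries => n _ _; rewrite lee_fin.
    apply: nearW => n; rewrite sumEFin lee_fin leNgt; apply/negP; exact: cx.
  by rewrite pE lee_fin leNgt x1.
have c_le1 n : c n <= 1.
  rewrite -lee_fin -pE /c -sumEFin; apply: nneseries_lim_ge => k _ _.
  by rewrite lee_fin.
pose J n : set RR := `[c n, c n.+1[%classic.
have mJ n : measurable (J n) by exact: measurable_itv.
have J_uniq m n x : J m x -> J n x -> m = n.
  rewrite /J/= !in_itv/= => /andP[m1 m2] /andP[n1 n2].
  apply/eqP; rewrite eqn_leq; apply/andP; split; rewrite leqNgt; apply/negP.
    by move=> /c_le /(lt_le_trans n2) /(le_lt_trans m1); rewrite ltxx.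
  by move=> /c_le /(lt_le_trans m2) /(le_lt_trans n1); rewrite ltxx.
have J_ex x : 0 <= x < 1 -> exists n, J n x.
  move=> /andP[x0 x1]; have [n xn min_n] := ex_minnP (c_lt1 x x1).
  case: n => [|n] in xn min_n *; first by move: xn; rewrite c0 ltNge x0.
  exists n; rewrite /J/= in_itv/= xn andbT leNgt; apply/negP => /min_n.
  by rewrite ltnn.
have J_sub n x : J n x -> 0 <= x < 1.
  rewrite /J/= in_itv/= => /andP[cx xc]; apply/andP; split.
    by apply: le_trans cx; rewrite -c0; exact: c_le.
  exact: lt_le_trans xc (c_le1 _).
have J_Dm n x : J n x -> 0 < p n.
  rewrite /J/= in_itv/= => /andP[cx /(le_lt_trans cx)].
  by rewrite cS ltrDl.
(* Points outside [0, 1) receive the default index 0; they are null for the restricted Lebesgue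
   measure [Q]. *)
pose idx (x : R) : nat := if pselect (exists n, J n x) is left h then projT1 (cid h) else 0%N.
have idxE n x : J n x -> idx x = n.
  move=> Jn; rewrite /idx; case: pselect => [h|[]]; last by exists n.
  by case: cid => /= m Jm; exact: J_uniq Jm Jn.
pose D (x : RR) : G := e (idx x).
pose T (x : RR) : RR := (x - c (idx x)) / p (idx x).
have m01 : measurable (`[0, 1[%classic : set RR) by exact: measurable_itv.
have mIdx (A : set nat) : measurable [set x : RR | A (idx x)].
  rewrite (_ : [set x | _] = (\bigcup_(n in A) J n) `|`
      (~` (`[0, 1[%classic : set RR) `&` [set _ | A 0%N])).
    apply: measurableU; first exact: bigcup_measurable.
    apply: measurableI; first exact: measurableC.
    have [A0|A0] := pselect (A 0%N).
      rewrite (_ : [set _ : RR | A 0%N] = setT); first exact: measurableT.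
      by apply/seteqP; split=> x /=.
    rewrite (_ : [set _ : RR | A 0%N] = set0); first exact: measurable0.
    by apply/seteqP; split=> x /=.
  apply/seteqP; split=> [x /= Ax|x [[n An Jn]|/= [nx A0]]].
  - have [h|h] := pselect (exists n, J n x).
      by case: h => n Jn; left; exists n => //=; rewrite -(idxE _ _ Jn).
    right; split; last by move: Ax; rewrite /idx; case: pselect.
    by rewrite in_itv/= => /J_ex.
  - by rewrite /= (idxE n).
  - rewrite /= /idx; case: pselect => //= -[n Jn].
    by exfalso; apply: nx; rewrite in_itv/=; exact: J_sub Jn.
have mAff c' p' : measurable_fun setT ((fun x : R => (x - c') / p') : RR -> RR).
  apply: continuous_measurable_fun => x.
  by apply: cvgM; [apply: cvgB; [exact: cvg_id|exact: cvg_cst]|exact: cvg_cst].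
have mD A : measurable (D @^-1` A) by exact: (mIdx (e @^-1` A)).
have mT B : measurable B -> measurable (T @^-1` B).
  move=> mB; rewrite (_ : _ @^-1` _ = \bigcup_n ([set x : RR | idx x = n] `&`
      (fun x : R => (x - c n) / p n) @^-1` B)).
    apply: bigcup_measurable => n _; apply: measurableI; first exact: (mIdx [set n]).
    by rewrite -[_ @^-1` _]setTI; exact: mAff.
  apply/seteqP; split=> [x Bx|x [n _ [/= <-]]//].
  by exists (idx x).
pose Q : {measure set RR -> \bar R} := mrestr leb m01.
have Q1 : Q setT = 1%E.
  by rewrite /Q /= /mrestr setTI lebesgue_measure_itv/= lte_fin ltr01 sube0.
pose P : probability RR R := mk_probability Q1.
exists P, (fun i w => D (iter i T w)).
apply: (bernoulli_iid hmu cG mD mT) => s B mB.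
have [_ _ /(_ s I)[n /= Dn ns]] := eD.
have einj m : Dm m -> e m = e n -> m = n.
  by move=> Dm' emn; have [_ inj _] := eD; apply: inj => //; rewrite inE.
have -> : mu s = p n by rewrite /p Dn ns.
pose U : set RR := `[0, 1[%classic.
suff : (leb ((D @^-1` [set s] `&` T @^-1` B) `&` U) =
    (p n)%:E * leb (B `&` U))%E by [].
have DE : D @^-1` [set s] `&` T @^-1` B `&` U =
    J n `&` (fun x : R => (x - c n) / p n) @^-1` (B `&` U).
  apply/seteqP; split=> [x [[/= Ds Tx]]|x [Jx [/= Bx _]]].
    rewrite /U/= in_itv/= => x01; have [m Jm] := J_ex _ x01.
    have mn : m = n.
      apply: einj; last by rewrite ns -Ds /D (idxE m).
      by move: (J_Dm _ _ Jm); rewrite /p; case: ifP => //; rewrite ltxx.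
    move: Tx; rewrite /T (idxE m)// mn => Tx.
    have pn := J_Dm _ _ Jm; rewrite mn in pn Jm; split => //; split => //=.
    move: Jm; rewrite /J /U/= !in_itv/= ler_pdivlMr// ltr_pdivrMr// cS.
    by move=> /andP[? ?]; apply/andP; split; lra.
  split; last by rewrite /U /= in_itv/=; exact: J_sub Jx.
  by split; rewrite /= /D /T (idxE n).
rewrite DE.
have [pn0|pn] := eqVneq (p n) 0.
  rewrite pn0 mul0e (_ : J n = set0) ?set0I ?measure0//.
  by apply/seteqP; split => // x /J_Dm; rewrite pn0 ltxx.
have {}pn : 0 < p n by rewrite lt_neqAle eq_sym pn p0.
rewrite -(lebesgue_affine (c n) pn (measurableI _ _ mB m01)).
congr (leb _); apply: setIidr => x /= [_].
rewrite /J /U/= !in_itv/= ler_pdivlMr// ltr_pdivrMr// cS.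
by move=> /andP[? ?]; apply/andP; split; lra.
Qed.

End iid_existence.

(** * Compact metric spaces and costs of stationary measures *)

Definition is_metric_for {R : realType} {X : topologicalType} (d : X -> X -> R) :=
  [/\ forall x y, d x y = 0 <-> x = y,
      forall x y, d x y = d y x,
      forall x y z, d x z <= d x y + d y z
    & forall x, nbhs x = nbhs_ball_ (fun y e => [set z | d y z < e]) x].

Section bounded_convergence.
Local Open Scope ereal_scope.
Context d (W : measurableType d) {R : realType} (P : probability W R).

Lemma bounded_cvg (f : nat -> W -> \bar R) (f0 : W -> \bar R) (c : R) :
  (forall n, measurable_fun setT (f n)) -> measurable_fun setT f0 ->
  (forall n w, 0 <= f n w <= c%:E) ->
  {ae P, forall w, f ^~ w @ \oo --> f0 w} ->
  \int[P]_w f n w @[n --> \oo] --> \int[P]_w f0 w.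
Proof.
move=> mf mf0 fc ff0.
have [] // := @dominated_convergence _ _ _ P setT measurableT f f0 (cst c%:E).
- by apply: filterS ff0 => w fw _.
- by apply: finite_measure_integrable_cst.
- by apply: aeW => w n _; have /andP[? ?] := fc n w; rewrite gee0_abs.
Qed.

End bounded_convergence.

Section metric_space.
Context {R : realType} {X : ptopologicalType} (d : X -> X -> R).
Hypothesis hd : is_metric_for d.

Let dxx x : d x x = 0. Proof. by case: hd => + _ _ _; move=> ->. Qed.
Let dC x y : d x y = d y x. Proof. by case: hd. Qed.
Let dT x y z : d x z <= d x y + d y z. Proof. by case: hd. Qed.

Lemma dist_ge0 x y : 0 <= d x y.
Proof. by have := dT x y x; rewrite dxx (dC y x); lra. Qed.

Lemma dist_lip x y p : `|d x p - d y p| <= d x y.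
Proof.
rewrite ler_norml; apply/andP; split.
  by have := dT y x p; rewrite (dC y x); lra.
by have := dT x y p; lra.
Qed.

Lemma nbhs_dist x (A : set X) :
  nbhs x A <-> exists2 e : R, 0 < e & [set z | d x z < e] `<=` A.
Proof.
have [_ _ _ ->] := hd; rewrite /nbhs_ball_ /filter_from/=.
by split=> -[e ? ?]; exists e.
Qed.

Lemma near_dist x (e : R) : 0 < e -> \forall z \near x, d x z < e.
Proof. by move=> e0; apply/nbhs_dist; exists e. Qed.

Lemma cvg_dist (u : nat -> X) x : (u @ \oo --> x) <-> (d (u n) x @[n --> \oo] --> 0).
Proof.
split=> ux.
  apply/(@cvgrPdist_lt _ R^o) => e e0.
  have : \forall n \near \oo, d x (u n) < e by exact: (ux _ (near_dist x e0)).
  by apply: filterS => n /=; rewrite sub0r normrN ger0_norm ?dist_ge0// dC.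
move=> A /nbhs_dist[e e0 eA].
move/(@cvgrPdist_lt _ R^o) : ux => /(_ e e0); apply: filterS => n.
rewrite sub0r normrN ger0_norm ?dist_ge0// dC => ?.
exact: eA.
Qed.

Lemma lipschitz_continuous (f : X -> R) (C : R) :
  (forall x y, `|f x - f y| <= C * d x y) -> continuous f.
Proof.
move=> fC x; apply/(@cvgrPdist_lt _ R^o) => e e0.
have C0 : 0 < `|C| + 1 by rewrite ltr_wpDl.
have := near_dist x (divr_gt0 e0 C0); apply: filterS => z.
rewrite ltr_pdivlMr// => dz; apply: le_lt_trans (fC _ _) _.
apply: le_lt_trans dz; rewrite [leRHS]mulrC ler_wpM2r ?dist_ge0//.
by rewrite (le_trans (ler_norm _))// lerDl.
Qed.

Lemma dist_continuous p : continuous (d ^~ p).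
Proof. by apply: (@lipschitz_continuous _ 1) => x y; rewrite mul1r dist_lip. Qed.

Lemma continuous_borel (f : X -> R) : continuous f ->
  measurable_fun setT (f : borel X -> R).
Proof.
move=> /continuousP cf; apply: (measurability _ (RGenOpens.measurableE R)).
move=> _ [_ [a [b ->] <-]]; rewrite setTI; apply: sub_sigma_algebra.
exact/cf/interval_open.
Qed.

Lemma continuous_borel_EFin (f : X -> R) : continuous f ->
  measurable_fun setT ((fun x => (f x)%:E) : borel X -> \bar R).
Proof. by move=> cf; apply/measurable_EFinP; exact: continuous_borel. Qed.

Lemma open_borel (A : set X) : open A -> measurable (A : set (borel X)).
Proof. exact: sub_sigma_algebra. Qed.

Lemma closed_borel (A : set X) : closed A -> measurable (A : set (borel X)).
Proof.
move=> cA; rewrite -[A]setCK; apply: measurableC.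
by apply: open_borel; exact: closed_openC.
Qed.

(* The indicator of an open set U is the increasing limit of the Lipschitz
   functions min 1 (n * dist (x, complement of U)). *)
Lemma borel_measure_unique (m1 m2 : probability (borel X) R) :
  (forall (f : X -> R) (C : R), 0 <= C ->
     (forall x, 0 <= f x <= 1) -> (forall x y, `|f x - f y| <= C * d x y) ->
     (\int[m1]_x (f x)%:E = \int[m2]_x (f x)%:E)%E) ->
  forall A : set (borel X), measurable A -> m1 A = m2 A.
Proof.
move=> m12 A mA.
apply: (@measure_unique _ R (borel X) (@open X) (fun=> setT)) => //.
- by move=> U V oU oV; exact: openI.
- by move=> _; exact: openT.
- by apply/seteqP; split => // x _; exists 0%N.
- move=> U oU.
  (* The distance to an empty complement makes no sense, hence the separate case. *)
  have [->|/eqP UT] := eqVneq U setT.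
    by rewrite /= !probability_setT.
  have [a0 Ua0] : exists a, ~ U a.
    by apply: contrapT => h; apply: UT; apply/seteqP; split => // x _;
       apply: contrapT => Ux; apply: h; exists x.
  pose S x := [set d x a | a in ~` U].
  pose D x := inf (S x).
  have S0 x : S x !=set0 by exists (d x a0), a0.
  have Slb x : has_lbound (S x).
    by exists 0 => _ [a _ <-]; exact: dist_ge0.
  have D0 x : 0 <= D x.
    by apply: lb_le_inf => // _ [a _ <-]; exact: dist_ge0.
  have Dlip x y : D x - D y <= d x y.
    rewrite lerBlDl -lerBlDr; apply: lb_le_inf => // _ [a Ua <-].
    rewrite lerBlDr addrC (le_trans _ (dT x y a))//.
    by apply: ge_inf => //; exists a.
  have Dnorm x y : `|D x - D y| <= d x y.
    by rewrite ler_norml Dlip andbT lerNl opprB dC Dlip.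
  have D_U x : U x -> 0 < D x.
    move=> Ux; have /nbhs_dist[e e0 eU] := open_nbhs_nbhs (conj oU Ux).
    apply: (lt_le_trans e0); apply: lb_le_inf => // _ [a Ua <-].
    by rewrite leNgt; apply/negP => /eU.
  have D_nU x : ~ U x -> D x = 0.
    move=> Ux; apply/eqP; rewrite eq_le D0 andbT.
    by apply: ge_inf => //; exists x.
  pose f n x := Num.min 1 (n%:R * D x).
  have f01 n x : 0 <= f n x <= 1.
    by rewrite /f ge_min lexx le_min ler01 mulr_ge0.
  have f_lip n x y : `|f n x - f n y| <= n%:R * d x y.
    have h z t : f n z - f n t <= n%:R * d z t.
      rewrite lerBlDr /f {2}/Order.min.
      case: ifPn => _; first by rewrite ge_min lerDr mulr_ge0// dist_ge0.
      rewrite ge_min -mulrDr; apply/orP; right; apply: ler_wpM2l => //.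
      by rewrite -lerBlDr.
    by rewrite ler_norml h andbT lerNl opprB (dC x y).
  have int_f (m : probability (borel X) R) :
      (\int[m]_x (f n x)%:E @[n --> \oo] --> m U)%E.
    have -> : m U = (\int[m]_x (\1_U x)%:E)%E.
      by rewrite integral_indic//= ?setIT//; exact: open_borel.
    apply: (@bounded_cvg _ _ _ _ _ _ 1).
    - move=> n; apply: continuous_borel_EFin.
      exact: lipschitz_continuous (f_lip n).
    - by apply/measurable_EFinP; apply: measurable_indic; exact: open_borel.
    - by move=> n x; rewrite !lee_fin.
    - apply: aeW => x; apply/fine_cvgP; split; first exact: nearW.
      have [Ux|Ux] := pselect (U x).
        rewrite indicE mem_set//=; apply: cvg_near_cst.
        near=> n; rewrite /f/= /Order.min; case: ifPn => //.
        rewrite -leNgt => h; apply/eqP; rewrite eq_le h/=.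
        rewrite -ler_pdivrMr ?D_U//; near: n.
        exact: nbhs_infty_ger.
      rewrite indicE memNset//=; apply: cvg_near_cst; apply: nearW => n.
      by rewrite /f/= D_nU// mulr0 /Order.min ltr10.
  have := int_f m2.
  have -> : (fun n => \int[m2]_x (f n x)%:E)%E = (fun n => \int[m1]_x (f n x)%:E)%E.
    by apply/funext => n; rewrite (m12 (f n) n%:R).
  by move=> h; exact: (cvg_unique (@ereal_hausdorff R) (int_f m1) h).
by move=> _; rewrite /= probability_setT ltry.
Unshelve. all: by end_near. Qed.

(** The maps [h n] to which this is applied are, off a null set, functions of the position in a
    countable group, so preimages of arbitrary sets are measurable. For open [U], [h0 w] lies in [U]
    iff for some m the ball of radius 1/(m+1) about [h k w] is eventually contained in [U]. *)
Lemma measurable_discrete_limit dW (W : measurableType dW) (h : nat -> W -> X)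
    (h0 : W -> X) :
  (forall n (A : set X), measurable (h n @^-1` A)) ->
  (forall w, h ^~ w @ \oo --> h0 w) ->
  measurable_fun setT (h0 : W -> borel X).
Proof.
move=> mh hh0; apply: (@measurability _ _ _ (borel X) _ _ (@open X)) => //.
move=> _ [U oU <-]; rewrite setTI.
pose V m := [set y | [set z | d y z < m.+1%:R^-1] `<=` U].
rewrite (_ : _ @^-1` _ = \bigcup_m \bigcup_K \bigcap_(k in [set k | (K <= k)%N]) (h k @^-1` V m)).
  apply: bigcup_measurable => m _; apply: bigcup_measurable => K _.
  by apply: bigcap_measurableType => k _; exact: mh.
apply/seteqP; split=> [w /= Uw|w [m _ [K _ hK]]].
  have /nbhs_dist[e e0 eU] := open_nbhs_nbhs (conj oU Uw).
  have /cvg_dist/(@cvgrPdist_lt _ R^o) := hh0 w.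
  have [m me] : exists m, (m.+1%:R^-1 : R) < e / 2.
    have := @near_infty_natSinv_lt R (PosNum (divr_gt0 e0 (ltr0Sn R 1))).
    by move=> [N _ NN]; exists N; apply: NN => /=.
  move=> /(_ _ (divr_gt0 e0 (ltr0Sn R 1)))[K _ hK].
  exists m => //; exists K => // k /= Kk z /= zk; apply: eU => /=.
  have := hK k Kk; rewrite sub0r normrN ger0_norm ?dist_ge0// => hk.
  have := dT (h0 w) (h k w) z; rewrite (dC (h0 w) (h k w)) => hh.
  rewrite (splitr e); apply: le_lt_trans hh _; apply: ltrD => //; exact: lt_trans me.
have /cvg_dist/(@cvgrPdist_lt _ R^o) := hh0 w.
move=> /(_ m.+1%:R^-1 (ltac:(by rewrite invr_gt0 ltr0Sn)))[K' _ hK'].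
pose k := maxn K K'.
have := hK' k (leq_maxr _ _); rewrite sub0r normrN ger0_norm ?dist_ge0// => hk.
by apply: (hK k (leq_maxl _ _)).
Qed.

Section compact.
Hypothesis cX : compact [set: X].

Lemma compact_bound (f : X -> R) : continuous f -> exists2 B, 0 <= B & forall x, `|f x| <= B.
Proof.
move=> cf.
have cnf : continuous (fun x => `|f x|).
  by move=> x; apply: continuous_comp; [exact: cf|exact: norm_continuous].
have X0 : [set: X] !=set0 by exists point.
have [x _ xmax] := compact_EVT_max X0 cX (continuous_subspaceT cnf).
by exists `|f x| => // y; apply: xmax; rewrite inE.
Qed.

Lemma diam_bound : exists2 B, 0 < B & forall x y, d x y <= B.
Proof.
have [B B0 hB] := compact_bound (@dist_continuous point).
exists (B + B + 1); first by rewrite ltr_wpDl// addr_ge0.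
move=> x y; have := dT x point y; rewrite (dC point).
have := le_trans (ler_norm _) (hB x); have := le_trans (ler_norm _) (hB y).
lra.
Qed.

(** Near [x0] continuity gives [e]; at distance at least [D] the bound [2 * B] on the variation is
    paid for by the slope [2 * B / D]. Thus a small cost controls every continuous test function. *)
Lemma continuous_affine_bound (f : X -> R) x0 (e : R) : continuous f -> 0 < e ->
  exists2 C, 0 <= C & forall x, `|f x - f x0| <= e + C * d x x0.
Proof.
move=> cf e0; have [B B0 hB] := compact_bound cf.
have /nbhs_dist[D D0 hD] : \forall x \near x0, `|f x0 - f x| < e.
  by have /cvgrPdist_lt/(_ e e0) := cf x0.
exists ((B + B) / D); first by rewrite divr_ge0 ?addr_ge0// ltW.
move=> x; have [xD|xD] := ltP (d x0 x) D.
  rewrite distrC (le_trans (ltW (hD x xD)))// lerDl mulr_ge0 ?dist_ge0//.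
  by rewrite divr_ge0 ?addr_ge0// ltW.
rewrite (le_trans (ler_normB _ _))// (@le_trans _ _ (B + B))//.
  by apply: lerD.
rewrite -[leLHS]add0r lerD//; first exact: ltW.
rewrite -mulrA; apply: ler_peMr; first exact: addr_ge0.
by rewrite ler_pdivlMl// mulr1 dC.
Qed.

Lemma exists_minimizer (f : X -> R) : continuous f ->
  exists x, forall y, f x <= f y.
Proof.
move=> cf; have X0 : [set: X] !=set0 by exists point.
have [x _ xmin] := compact_EVT_min X0 cX (continuous_subspaceT cf).
by exists x => y; apply: xmin; rewrite inE.
Qed.

Lemma cluster_seq (u : nat -> X) :
  exists x, forall (e : R) N, 0 < e -> exists2 n, (N <= n)%N & d x (u n) < e.
Proof.
have [|x [_ xu]] := @cX (u @ \oo) _; first exact: filterT.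
exists x => e N e0.
have [] := xu [set y | exists2 n, (N <= n)%N & u n = y] [set y | d x y < e].
- by exists N => // n /= Nn; exists n.
- exact: near_dist.
- by move=> _ [[n Nn <-] /= ?]; exists n.
Qed.

End compact.
End metric_space.

Section dynamics.
Context {R : realType} {G : groupType} {X : ptopologicalType}.
Variables (act : G -> X -> X) (d : X -> X -> R).
Hypotheses (hG : is_Gspace act) (hd : is_metric_for d).
Implicit Types (nu : probability (borel X) R) (f : X -> R).

Let cX : compact [set: X]. Proof. by case: hG. Qed.
Let act1 x : act 1%g x = x. Proof. by case: hG. Qed.
Let actM g h x : act (g * h)%g x = act g (act h x). Proof. by case: hG. Qed.
Let actc g : continuous (act g). Proof. by case: hG. Qed.

Lemma act_borel g : measurable_fun setT (act g : borel X -> borel X).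
Proof.
apply: (@measurability _ _ _ (borel X) _ _ (@open X)) => //.
move=> _ [U oU <-]; rewrite setTI; apply: sub_sigma_algebra.
by move/continuousP : (@actc g) => /(_ _ oU).
Qed.

Lemma continuous_act f g : continuous f -> continuous (fun x => f (act g x)).
Proof. by move=> cf x; apply: continuous_comp; [exact: actc|exact: cf]. Qed.

Lemma dist_act_continuous g p : continuous (fun x => d (act g x) p).
Proof. exact: (continuous_act (dist_continuous hd (p := p))). Qed.

Lemma continuous_integrable nu f : continuous f ->
  nu.-integrable setT (EFin \o (f : borel X -> R)).
Proof.
move=> cf; have [B B0 hB] := compact_bound cX cf.
apply: (le_integrable _ _ _ (finite_measure_integrable_cst nu B measurableT)) => //.
- exact: continuous_borel_EFin.
- by move=> x _ /=; rewrite lee_fin (ger0_norm B0).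
Qed.

Lemma EFin_integral nu f : continuous f ->
  (\int[nu]_x f x)%:E = (\int[nu]_x (f x)%:E)%E.
Proof.
move=> cf; rewrite /Rintegral fineK//.
by apply: integrable_fin_num => //; exact: continuous_integrable.
Qed.

Lemma integral_translate nu g f : continuous f ->
  (\int[translate act nu g]_(x in [set: borel X]) (f x)%:E)%E =
  (\int[nu]_x f (act g x))%:E.
Proof.
move=> cf; rewrite EFin_integral; last exact: continuous_act.
rewrite /translate (@integral_pushforward _ _ (borel X) (borel X))//.
- exact: act_borel.
- exact: continuous_borel_EFin.
- by apply: (continuous_integrable _ (continuous_act (g := g) cf)).
Qed.

(** The Wasserstein distance between the translate [g nu] and the Dirac mass at [p]. *)
Definition cost nu (g : G) (p : X) : R := \int[nu]_x d (act g x) p.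

Lemma cost_ge0 nu g p : 0 <= cost nu g p.
Proof. by apply: Rintegral_ge0 => x _; exact: dist_ge0. Qed.

Lemma le_continuous_integral nu f1 f2 : continuous f1 -> continuous f2 ->
  (forall x, f1 x <= f2 x) -> \int[nu]_x f1 x <= \int[nu]_x f2 x.
Proof.
by move=> c1 c2 h; apply: le_Rintegral => //; exact: continuous_integrable.
Qed.

Lemma integral_cst1 nu (c : R) : \int[nu]_x c = c.
Proof. by rewrite Rintegral_cst//= probability_setT mulr1. Qed.

Lemma integralD_cst nu f (c : R) : continuous f ->
  \int[nu]_x (c + f x) = c + \int[nu]_x f x.
Proof.
move=> cf; rewrite RintegralD ?integral_cst1//.
  by apply: continuous_integrable; exact: cst_continuous.
exact: continuous_integrable.
Qed.

Lemma cost_triangle nu g p q : cost nu g p <= d p q + cost nu g q.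
Proof.
have [_ dC dT _] := hd.
rewrite -integralD_cst; last exact: dist_act_continuous.
apply: le_continuous_integral; first exact: dist_act_continuous.
  by move=> x; apply: cvgD; [exact: cvg_cst|exact: dist_act_continuous].
by move=> x; rewrite addrC (dC p q); exact: dT.
Qed.

Lemma dist_cost nu g p q : d p q <= cost nu g p + cost nu g q.
Proof.
have [_ dC dT _] := hd.
rewrite -RintegralD//; try by apply: continuous_integrable; exact: dist_act_continuous.
rewrite -[leLHS](integral_cst1 nu); apply: le_continuous_integral.
- exact: cst_continuous.
- by move=> x; apply: cvgD; exact: dist_act_continuous.
- by move=> x; rewrite (dC (act g x) p); exact: dT.
Qed.

Lemma weak_star_dirac nu (h : nat -> G) (p : borel X) :
  cost nu (h k) p @[k --> \oo] --> 0 ->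
  weak_star_cvg (fun k => translate act nu (h k)) \d_p.
Proof.
move=> hp f cf.
rewrite integral_dirac//=; last exact: continuous_borel_EFin.
rewrite diracT mul1e.
under eq_fun do rewrite integral_translate//.
apply/cvg_EFin; first exact: nearW.
apply/(@cvgrPdist_le _ R^o) => e e0 /=.
have e20 : 0 < e / 2 by rewrite divr_gt0.
have [C C0 hC] := continuous_affine_bound hd cX p cf e20.
(* [C] may vanish, so the cost is compared with a fraction of [C + 1]. *)
have C1 : 0 < C + 1 by rewrite ltr_wpDl.
move/(@cvgrPdist_lt _ R^o) : hp => /(_ _ (divr_gt0 e20 C1)).
apply: filterS => k; rewrite sub0r normrN ger0_norm ?cost_ge0// => hk.
have cfk := continuous_act (g := h k) cf.
have cdk := dist_act_continuous (g := h k) (p := p).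
have bnd (F : X -> R) : continuous F -> (forall x, F x <= e / 2 + C * d (act (h k) x) p) ->
    \int[nu]_x F x <= e.
  move=> cF hF; apply: (@le_trans _ _ (\int[nu]_x (e / 2 + C * d (act (h k) x) p))).
    apply: le_continuous_integral => //.
    move=> x; apply: cvgD; first exact: cvg_cst.
    by apply: cvgM; [exact: cvg_cst|exact: cdk].
  rewrite integralD_cst; last first.
    by move=> x; apply: cvgM; [exact: cvg_cst|exact: cdk].
  rewrite RintegralZl//; last exact: continuous_integrable.
  rewrite [leRHS]splitr lerD2l.
  apply: (@le_trans _ _ ((C + 1) * cost nu (h k) p)).
    by rewrite ler_wpM2r ?cost_ge0// lerDl.
  by rewrite mulrC -ler_pdivlMr// ltW.
have cfpB : continuous (fun x => f p - f (act (h k) x)).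
  by move=> x; apply: cvgB; [exact: cvg_cst|exact: cfk].
have -> : f p - \int[nu]_x f (act (h k) x) = \int[nu]_x (f p - f (act (h k) x)).
  rewrite RintegralB//; last 2 first.
  - by apply: continuous_integrable; exact: cst_continuous.
  - exact: continuous_integrable.
  by rewrite integral_cst1.
apply: le_trans (le_normr_Rintegral _ _) _ => //.
  exact: continuous_integrable.
apply: bnd.
  by move=> x; apply: (continuous_comp (cfpB x)); exact: norm_continuous.
by move=> x; rewrite distrC.
Qed.

Lemma weak_star_integral nu (h : nat -> G) (p : borel X) f :
  weak_star_cvg (fun k => translate act nu (h k)) \d_p ->
  continuous f -> \int[nu]_x f (act (h k) x) @[k --> \oo] --> f p.
Proof.
move=> hp cf; have := hp f cf.
rewrite integral_dirac//=; last exact: continuous_borel_EFin.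
rewrite diracT mul1e; under eq_fun do rewrite integral_translate//.
by move/fine_cvgP => [].
Qed.

Section stationary.
Variables (mu : G -> R) (nu : probability (borel X) R).
Hypotheses (hmu : is_prob mu) (cG : countable [set: G]).
Hypothesis hst : stationary act mu nu.

Lemma stationary_integral (f : borel X -> \bar R) : measurable_fun setT f ->
  (forall x, 0 <= f x)%E ->
  (\int[nu]_x f x = \esum_(s in [set: G]) ((mu s)%:E * \int[nu]_x f (act s x)))%E.
Proof.
move=> mf f0.
pose A s : {mfun borel X >-> borel X} :=
  HB.pack (act s : borel X -> borel X) (isMeasurableFun.Build _ _ _ _ _ (@act_borel s)).
have [m [mE mint]] := mixture (1%g : G) (fun s => distribution nu (A s)) cG hmu.1.
rewrite (eq_measure_integral m); last first.
  by move=> B mB _; rewrite mE; exact/esym/(hst mB).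
rewrite mint//; apply: eq_esum => s _.
by rewrite ge0_integral_pushforward.
Qed.

(** [u] is the Poisson transform of [f]; its harmonicity is stationarity tested on [f] translated by
    [g]. *)
Lemma stationary_harmonic f : continuous f -> (forall x, 0 <= f x) ->
  let u g := (\int[nu]_x f (act g x))%:E in avg mu u = u.
Proof.
move=> cf f0 u; apply/funext => g.
rewrite /u EFin_integral; last exact: continuous_act.
rewrite (stationary_integral (f := fun x => (f (act g x))%:E)); last 2 first.
- by apply: continuous_borel_EFin; exact: continuous_act.
- by move=> x; rewrite lee_fin.
apply: eq_esum => s _; congr (_ * _)%E.
rewrite EFin_integral; last exact: continuous_act.
by apply: eq_integral => x _; rewrite actM.
Qed.

Lemma cost_harmonic p : avg mu (fun g => (cost nu g p)%:E) = (fun g => (cost nu g p)%:E).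
Proof.
apply: (stationary_harmonic (f := d ^~ p)).
  exact: dist_continuous.
by move=> x; exact: dist_ge0.
Qed.

End stationary.
End dynamics.

(** * A criterion for boundaries *)

Section boundary_criterion.
Context {R : realType} {G : groupType} {X : ptopologicalType}.
Variables (act : G -> X -> X) (d : X -> X -> R).
Hypotheses (hG : is_Gspace act) (hd : is_metric_for d).
Variables (mu : G -> R) (nu : probability (borel X) R) (a : G -> X).
Hypotheses (hmu : is_prob mu) (cG : countable [set: G]).
Hypothesis hst : stationary act mu nu.

Let cX : compact [set: X]. Proof. by case: hG. Qed.

Let V (g : G) : \bar R := (cost act d nu g (a g))%:E.
Let V0 g : (0 <= V g)%E. Proof. by rewrite lee_fin; exact: cost_ge0. Qed.

(** The target point is frozen at time [m] while the walk goes on: with a fixed target the cost is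
    harmonic in the later positions. *)
Definition deviation (W : Type) (g : nat -> W -> G) (e : R) m n : set W :=
  [set w | exists2 j, (j <= n)%N &
    (e%:E <= (cost act d nu (walk g (m + j) w) (a (walk g m w)))%:E)%E].

Section along_walk.
Context dW (W : measurableType dW) (P : probability W R) (g : nat -> W -> G).
Hypothesis giid : iid_of_law mu P g.

Local Notation dev := (deviation g).

Lemma measurable_deviation e m n : measurable (dev e m n).
Proof.
rewrite (_ : dev e m n = \bigcup_(j in [set j | (j <= n)%N])
    [set w | e%:E <= (cost act d nu (walk g (m + j) w) (a (walk g m w)))%:E]%E).
  apply: bigcup_measurable => j _.
  exact: (walk2_preimage cG giid (m + j) m
    (fun h h' => e%:E <= (cost act d nu h (a h'))%:E)%E).
by apply/seteqP; split=> w [j]; exists j.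
Qed.

Lemma deviation_cylinder e k b n : 0 < e ->
  (e%:E * P (cylinder g b `&` dev e (size b + k) n) <=
   (weight mu b)%:E * iter k (avg mu) V (wprod b))%E.
Proof.
move=> e0; elim: k b => [|k ih] b.
  pose u h := (cost act d nu h (a (wprod b)))%:E.
  have := @maximal_ineq R G mu hmu dW W P g cG giid n b u e e0.
  rewrite /u -/(cost _ _ _ _ _) => h.
  apply: le_trans (h _ _); last 2 first.
  - by move=> ?; rewrite lee_fin; exact: cost_ge0.
  - by move=> ?; rewrite (cost_harmonic hG hd hmu cG hst).
  rewrite addn0 (_ : cylinder g b `&` dev _ _ _ = cylinder g b `&` [set w |
    exists2 j, (j <= n)%N & (e%:E <= (cost act d nu (walk g (size b + j) w) (a (wprod b)))%:E)%E])//.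
  apply/seteqP; split=> w [bw [j jn ej]]; split => //; exists j => //.
    by rewrite -(cylinder_walk bw).
  by rewrite (cylinder_walk bw).
rewrite (_ : cylinder g b `&` dev _ _ _ = \bigcup_s (cylinder g (rcons b s) `&`
  dev e (size (rcons b s) + k) n)); last first.
  rewrite -cylinder_rcons_bigcup setI_bigcupl; apply: eq_bigcupr => s _.
  by rewrite size_rcons addnS -addSn.
rewrite measure_partition//; last 2 first.
- by move=> s; apply: measurableI; [exact: (measurable_cylinder giid)|exact: measurable_deviation].
- have /trivIsetP tc := @cylinder_rcons_trivIset G dW W g b.
  by apply/trivIsetP => s t _ _ st; rewrite setIACA tc// set0I.
rewrite -esumZl//; last exact: ltW.
rewrite /= /avg -esumZl; last 2 first.
- exact: weight_ge0.
- by move=> s; rewrite mule_ge0 ?lee_fin; [|apply hmu.1|exact: iter_avg_ge0].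
apply: le_esum => s _; apply: le_trans (ih _) _.
by rewrite weight_rcons wprod_rcons EFinM muleA.
Qed.

Lemma deviation_bound e k : 0 < e ->
  (e%:E * P (\bigcup_n dev e k n) <= iter k (avg mu) V 1%g)%E.
Proof.
move=> e0; rewrite muleC -lee_pdivlMr//.
have cv : P (dev e k n) @[n --> \oo] --> P (\bigcup_n dev e k n).
  apply: nondecreasing_cvg_mu => [n||].
  - exact: measurable_deviation.
  - by apply: bigcup_measurable => n _; exact: measurable_deviation.
  - move=> m n mn; apply/subsetPset => w [j jm ej]; exists j => //.
    exact: leq_trans mn.
rewrite -(cvg_lim _ cv)//; apply: lime_le; first by apply/cvg_ex; exists (P (\bigcup_n dev e k n)).
apply: nearW => n; rewrite lee_pdivlMr// muleC.
have := deviation_cylinder k [::] n e0.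
by rewrite cylinder_nil setTI add0n /weight big_nil mul1e /wprod big_nil.
Qed.

End along_walk.

(* The maximal inequality is applied to the nonnegative harmonic functions
   g |-> cost nu g p, with p the value of [a] at time k. *)
Lemma boundary_criterion :
  iter k (avg mu) V 1%g @[k --> \oo] --> 0%E -> is_boundary act mu nu.
Proof.
move=> hV dW W P g giid.
have h m : {ae P, forall w, exists k, forall j,
    cost act d nu (walk g (k + j) w) (a (walk g k w)) < m.+1%:R^-1}.
  pose e : R := m.+1%:R^-1.
  have e0 : 0 < e by rewrite invr_gt0.
  (* A path that is bad for [e] deviates after every time [k]; the probability of this lies below
     all the bounds of [deviation_bound], which tend to 0. *)
  pose B k := \bigcup_n deviation g e k n.
  have mB k : measurable (B k).
    by apply: bigcup_measurable => n _; exact: (measurable_deviation giid).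
  exists (\bigcap_k B k); split.
  - exact: bigcap_measurableType.
  - apply/eqP; rewrite -measure_le0 -(@pmule_rle0 _ e%:E)//.
    have := hV; apply: cvge_ge; apply: nearW => k.
    apply: le_trans (deviation_bound giid k e0).
    apply: lee_wpmul2l; first by rewrite lee_fin ltW.
    apply: le_measure; rewrite ?inE//; first exact: bigcap_measurableType.
      exact: mB.
    by move=> w /(_ k I).
  - move=> w /= hw k _; apply: contrapT => nB; apply: hw; exists k => j.
    rewrite ltNge; apply/negP => ej; apply: nB; exists j => //; exists j => //.
have {}h := ae_foralln h.
apply: filterS h => w hw.
have [k hk] := choice hw.
(* A cluster point suffices: after time [k m] the whole path stays concentrated near
   [a (walk g (k m) w)], so nearness of this point to [x] for one large [m] persists at all later
   times. *)
have [x hx] := cluster_seq hd cX (fun m => a (walk g (k m) w)).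
exists x; apply: (weak_star_dirac hG hd).
apply/(@cvgrPdist_lt _ R^o) => e e0 /=.
have e20 : 0 < e / 2 by rewrite divr_gt0.
have [N _ hN] := @near_infty_natSinv_lt R (PosNum e20).
have [m Nm dm] := hx (e / 2) N e20.
exists (k m) => // n /= kn.
rewrite sub0r normrN ger0_norm ?cost_ge0//.
apply: le_lt_trans (cost_triangle hG hd nu _ _ (a (walk g (k m) w))) _.
rewrite [ltRHS]splitr; apply: ltrD => //.
apply: lt_trans (hN m Nm); rewrite -(subnKC kn); exact: hk.
Qed.
End boundary_criterion.

(** * Powers of a mean-proximal space *)

Section power_space.
Context (n : nat) (X : ptopologicalType).

Definition power : Type := prod_topology (fun _ : 'I_n => X).

HB.instance Definition _ := Topological.on power.
HB.instance Definition _ := isPointed.Build power (fun _ => point).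

Lemma power_proj_continuous i : continuous (fun y : power => y i).
Proof. exact: (@proj_continuous _ (fun _ : 'I_n => X) i). Qed.

Lemma continuous_to_power (T : topologicalType) (f : T -> power) :
  (forall i, continuous (fun t => f t i)) -> continuous f.
Proof.
move=> cf t; apply/cvg_sup => i A.
rewrite (@nbhsE (initial_topology (fun y : forall i : 'I_n, X => y i))); move=> [U [oU Ut] UA].
apply: (filterS UA); case: oU => O oO OU; rewrite -OU in Ut *.
by apply: (cf i t); apply: open_nbhs_nbhs.
Qed.

Lemma power_compact : compact [set: X] -> compact [set: power].
Proof.
move=> cX; have := @tychonoff 'I_n (fun _ => X) (fun _ => setT) (fun _ => cX).
by congr compact; apply/seteqP.
Qed.

Context {R : realType} (d : X -> X -> R).
Hypothesis hd : is_metric_for d.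

(** The sum, rather than the maximum, of the coordinate distances makes the cost of a measure on the
    power the sum of the costs of its marginals. *)
Definition power_dist (y z : power) : R := \sum_(i < n) d (y i) (z i).

Lemma power_dist_metric : is_metric_for power_dist.
Proof.
have [d0 dC dT _] := hd.
have dge := dist_ge0 hd.
have le_pd i (y z : power) : d (y i) (z i) <= power_dist y z.
  by rewrite /power_dist (bigD1 i)//= lerDl sumr_ge0.
split.
- move=> y z; split=> [yz|->]; last by rewrite /power_dist big1// => i _; apply/d0.
  apply/funext => i; apply/d0/eqP; rewrite eq_le dge andbT.
  by rewrite -yz; exact: le_pd.
- by move=> y z; apply: eq_bigr.
- by move=> x y z; rewrite -big_split/=; apply: ler_sum.
- move=> y; apply/seteqP; split=> A.
    suff : nbhs_ball_ (fun y e => [set z | power_dist y z < e]) y --> y by exact.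
    have FF : Filter (nbhs_ball_ (fun y e => [set z | power_dist y z < e]) y).
      apply: filter_from_filter; first by exists 1 => /=.
      move=> e f /= e0 f0; exists (Num.min e f); first by rewrite lt_min e0.
      by move=> z /=; rewrite lt_min => /andP[].
    apply/cvg_sup => i B.
    rewrite (@nbhsE (initial_topology (fun y : forall i : 'I_n, X => y i))); move=> [U [oU Uy] UB].
    apply: (filterS UB); case: oU => O oO OU; rewrite -OU in Uy *.
    have /(nbhs_dist hd)[e e0 eO] := open_nbhs_nbhs (conj oO Uy).
    exists e => // z /= yz; apply: eO => /=.
    exact: le_lt_trans (le_pd i y z) yz.
  move=> [e /= e0 eA]; apply: (filterS eA).
  (* Dividing by [n.+1] instead of [n] covers [n = 0] and makes the final inequality strict. *)
  have e1 : 0 < e / n.+1%:R by rewrite divr_gt0.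
  have : \forall z \near y, forall i, d (y i) (z i) < e / n.+1%:R.
    apply: (@filter_forall power _ (fun i z => d (y i) (z i) < e / n.+1%:R) (nbhs y)) => i.
    exact: (@power_proj_continuous i y _ (near_dist hd (y i) e1)).
  apply: filterS => z yz /=.
  apply: (@le_lt_trans _ _ (\sum_(i < n) e / n.+1%:R)).
    by apply: ler_sum => i _; exact/ltW/yz.
  rewrite sumr_const card_ord -[ltLHS]mulr_natr -mulrA gtr_pMr//.
  by rewrite mulrC ltr_pdivrMr// mul1r ltr_nat.
Qed.
End power_space.

(** * Limits of averages and uniqueness of stationary measures *)

Section avg_more.
Local Open Scope ereal_scope.
Context {R : realType} {G : groupType} (mu : G -> R).
Hypotheses (hmu : is_prob mu) (cG : countable [set: G]).
Implicit Types u v : G -> \bar R.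

Lemma avg_shift u s h : avg mu (fun t => u (s * t)%g) h = avg mu u (s * h)%g.
Proof. by apply: eq_esum => t _; rewrite mulgA. Qed.

Lemma iter_avg_shift k u s h :
  iter k (avg mu) (fun t => u (s * t)%g) h = iter k (avg mu) u (s * h)%g.
Proof.
elim: k h => //= k ih h; rewrite -avg_shift; congr avg.
by apply/funext => t; rewrite ih.
Qed.

(** One step of an i.i.d. walk turns [avg] into an integral against a probability, where bounded
    convergence applies. *)
Lemma avg_cvg (u : nat -> G -> \bar R) v (c : R) g :
  (forall k h, 0 <= u k h <= c%:E) -> (forall h, u ^~ h @ \oo --> v h) ->
  avg mu (u k) g @[k --> \oo] --> avg mu v g.
Proof.
move=> uc uv.
have [P [x xiid]] := exists_iid hmu cG.
have u0 k h : 0 <= u k h by have /andP[] := uc k h.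
have v0 h : 0 <= v h by apply: cvge_ge (uv h); apply: nearW => k; exact: u0.
have E w : (forall h, 0 <= w h) ->
    avg mu w g = \int[P]_t w (g * walk x 1 t)%g.
  move=> w0; rewrite (integral_walk hmu cG xiid 1 (u := fun h => w (g * h)%g))//.
  by rewrite iter_avg_shift mulg1.
rewrite E//; under eq_fun do rewrite E//.
apply: (bounded_cvg (c := c)).
- by move=> k; apply: (measurable_walk cG xiid 1 (fun h => u k (g * h)%g)).
- by apply: (measurable_walk cG xiid 1 (fun h => v (g * h)%g)).
- by move=> k t; exact: uc.
- by apply: aeW => t; exact: uv.
Qed.

(** The harmonic part of the Riesz decomposition of [v]: the iterates decrease by superharmonicity,
    and [avg] passes to their limit. *)
Lemma superharmonic_limit v (c : R) : (forall h, 0 <= v h <= c%:E) ->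
  (forall h, avg mu v h <= v h) ->
  exists v', [/\ forall h, 0 <= v' h <= v h, avg mu v' = v' &
    forall h, iter k (avg mu) v h @[k --> \oo] --> v' h].
Proof.
move=> vc hv.
have v0 h : 0 <= v h by have /andP[] := vc h.
pose a k h := iter k (avg mu) v h.
have a0 k h : 0 <= a k h by exact: iter_avg_ge0.
have aS k h : a k.+1 h <= a k h.
  rewrite /a iterSr; apply: le_iter_avg => // t; exact: avg_ge0.
have a_dec h : nonincreasing_seq (a ^~ h) by apply/nonincreasing_seqP => k; exact: aS.
have a_cvg h : a ^~ h @ \oo --> ereal_inf (range (a ^~ h)).
  exact: ereal_nonincreasing_cvgn.
exists (fun h => ereal_inf (range (a ^~ h))); split => //.
- move=> h; apply/andP; split.
    by apply: le_ereal_inf_tmp => _ [k _ <-].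
  by apply: ge_ereal_inf; exists (v h) => //; exists 0%N.
- apply/funext => h.
  have ac k t : 0 <= a k t <= c%:E.
    rewrite a0/=; elim: k => [|k ih]; first by have /andP[] := vc t.
    exact: le_trans (aS k t) ih.
  have h1 := avg_cvg (g := h) ac a_cvg.
  have h2 : a k.+1 h @[k --> \oo] --> ereal_inf (range (a ^~ h)).
    by rewrite (cvg_shiftS (a ^~ h)); exact: a_cvg.
  exact: (cvg_unique (@ereal_hausdorff R) h1 h2).
Qed.

End avg_more.

Section uniqueness.
Context {R : realType} {G : groupType} {X : ptopologicalType}.
Variables (act : G -> X -> X) (d : X -> X -> R).
Hypotheses (hG : is_Gspace act) (hd : is_metric_for d).
Variables (mu : G -> R).
Hypotheses (hmu : is_prob mu) (cG : countable [set: G]).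

Let cX : compact [set: X]. Proof. by case: hG. Qed.

(** Stated for any family of 1-Lipschitz functions, because it also serves for a sum of costs of
    measures on the factors, before there is a measure on the power. *)
Lemma exists_argmin (phi : G -> X -> R) :
  (forall g p q, phi g p <= d p q + phi g q) ->
  exists a : G -> X, forall g q, phi g (a g) <= phi g q.
Proof.
move=> hphi.
suff h g : exists p, forall q, phi g p <= phi g q.
  by have [a ha] := choice h; exists a.
apply: (exists_minimizer cX); apply: (@lipschitz_continuous _ _ _ hd _ 1) => x y.
have [_ dC _ _] := hd.
rewrite mul1r ler_norml; apply/andP; split.
  by rewrite lerNl opprB lerBlDr (dC x).
by rewrite lerBlDr.
Qed.

Lemma cost_bound : exists2 B, 0 < B & forall nu g p, cost act d nu g p <= B.
Proof.
have [B B0 hB] := diam_bound hd cX; exists B => // nu g p.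
rewrite /cost -[leRHS](integral_cst1 nu); apply: (le_continuous_integral hG).
- exact: (dist_act_continuous hG hd).
- exact: cst_continuous.
- by move=> x; exact: hB.
Qed.

(** A minimum of harmonic functions: compare with the cost of the point [a g], which is harmonic and
    agrees with the minimum at [g]. *)
Lemma cost_argmin_superharmonic nu (a : G -> X) : stationary act mu nu ->
  (forall g q, cost act d nu g (a g) <= cost act d nu g q) -> forall g,
  (avg mu (fun g => (cost act d nu g (a g))%:E) g <= (cost act d nu g (a g))%:E)%E.
Proof.
move=> hst ha g.
rewrite -[leRHS](congr1 (@^~ g) (cost_harmonic hG hd hmu cG hst (a g))).
apply: le_avg => // h; rewrite lee_fin ?ha//; exact: cost_ge0.
Qed.

(* Two stationary measures with equal costs are within 2 * C * V of each other
   on C-Lipschitz functions, at every point of the walk. *)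
Lemma stationary_unique (nu nu' : probability (borel X) R) (a : G -> X) :
  stationary act mu nu -> stationary act mu nu' ->
  (forall g p, cost act d nu g p = cost act d nu' g p) ->
  iter k (avg mu) (fun g => (cost act d nu g (a g))%:E) 1%g @[k --> \oo] --> 0%E ->
  forall A : set (borel X), measurable A -> nu A = nu' A.
Proof.
have [_ dC _ _] := hd.
have main (m m' : probability (borel X) R) (f : X -> R) (C : R) :
    stationary act mu m -> stationary act mu m' ->
    (forall g p, cost act d m g p = cost act d m' g p) ->
    iter k (avg mu) (fun g => (cost act d m g (a g))%:E) 1%g @[k --> \oo] --> 0%E ->
    0 <= C -> (forall x, 0 <= f x <= 1) ->
    (forall x y, `|f x - f y| <= C * d x y) ->
    (\int[m]_x (f x)%:E <= \int[m']_x (f x)%:E)%E.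
  move=> sm sm' cmm' hV C0 f01 fC.
  have cf := lipschitz_continuous hd fC.
  have f0 x : 0 <= f x by have /andP[] := f01 x.
  pose u (n : probability (borel X) R) g := (\int[n]_x f (act g x))%:E.
  have u0 n g : (0 <= u n g)%E by rewrite lee_fin; apply: Rintegral_ge0.
  pose V g := (cost act d m g (a g))%:E.
  have V0 g : (0 <= V g)%E by rewrite lee_fin; exact: cost_ge0.
  have C2 : 0 <= C + C by exact: addr_ge0.
  (* Having equal costs, both translates [g m] and [g m'] are concentrated near the same point
     [a g]; each integral of [f] differs from [f (a g)] by at most [C * V g]. *)
  have uu' g : (u m g <= u m' g + (C + C)%:E * V g)%E.
    have cfa := continuous_act hG (g := g) cf.
    have cda := dist_act_continuous hG hd (g := g) (p := a g).
    have ccd : continuous (fun x => C * d (act g x) (a g)).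
      by move=> x; apply: cvgM; [exact: cvg_cst|exact: cda].
    have h1 : \int[m]_x f (act g x) <= f (a g) + C * cost act d m g (a g).
      rewrite /cost -RintegralZl//; last exact: (continuous_integrable hG _ cda).
      rewrite -(integralD_cst hG)//.
      apply: (le_continuous_integral hG) => //.
        by move=> x; apply: cvgD; [exact: cvg_cst|exact: ccd].
      by move=> x; have := ler_norm (f (act g x) - f (a g)); have := fC (act g x) (a g); lra.
    have h2 : f (a g) <= \int[m']_x f (act g x) + C * cost act d m g (a g).
      rewrite cmm' /cost -RintegralZl//; last exact: (continuous_integrable hG _ cda).
      rewrite -RintegralD//; [|exact: (continuous_integrable hG)..].
      rewrite -[leLHS](integral_cst1 m'); apply: (le_continuous_integral hG).
      - exact: cst_continuous.
      - by move=> x; apply: cvgD; [exact: cfa|exact: ccd].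
      by move=> x; have := ler_norm (f (a g) - f (act g x)); have := fC (a g) (act g x);
        rewrite (dC (a g)); lra.
    rewrite /u /V -EFinM -EFinD lee_fin; lra.
  have um n : stationary act mu n -> (u n 1%g = \int[n]_x (f x)%:E)%E.
    move=> _; have [_ act1 _ _] := hG.
    rewrite /u (EFin_integral hG); last exact: (continuous_act hG).
    by apply: eq_integral => x _; rewrite act1.
  rewrite -!um//.
  have uE k : (u m 1%g <= u m' 1%g + (C + C)%:E * iter k (avg mu) V 1%g)%E.
    have hm : avg mu (u m) = u m by exact: (stationary_harmonic hG hmu cG sm cf f0).
    have hm' : avg mu (u m') = u m' by exact: (stationary_harmonic hG hmu cG sm' cf f0).
    rewrite -[in leLHS](iter_avg_harmonic k hm)
      -[X in (X + _)%E](congr1 (@^~ 1%g) (iter_avg_harmonic k hm')).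
    rewrite -iter_avgZ// -iter_avgD//; last by move=> h; rewrite mule_ge0// lee_fin.
    exact: le_iter_avg.
  have : (u m' 1%g + (C + C)%:E * iter k (avg mu) V 1%g)%E
      @[k --> \oo] --> (u m' 1%g + (C + C)%:E * 0)%E.
    apply: cvgeD; first by rewrite mule0 adde_defC fin_num_adde_defl.
      exact: cvg_cst.
    exact: cvgeZl.
  rewrite mule0 adde0; apply: cvge_ge; apply: nearW => k; exact: uE.
move=> sn sn' cc hV; apply: (borel_measure_unique hd) => f C C0 f01 fC.
apply/eqP; rewrite eq_le; apply/andP; split.
  exact: (main _ _ _ C).
apply: (main _ _ _ C) => //.
by under eq_fun do under [X in iter _ _ X]eq_fun do rewrite -cc.
Qed.

End uniqueness.

(** * Powers of an action twisted by automorphisms, and their contraction *)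

Section twist.
Context {R : realType} {L : groupType} (t tV : L -> L).
Hypotheses (tK : cancel t tV) (tVK : cancel tV t).
Hypothesis tM : forall l l', t (l * l')%g = (t l * t l')%g.
Variable mu : L -> R.

Definition twist_law (l : L) : R := mu (tV l).

Let t_bij : set_bij [set: L] [set: L] t.
Proof.
split=> //; first by move=> x y _ _; exact: (can_inj tK).
by move=> l _; exists (tV l).
Qed.

Lemma twist_law_esum (F : L -> \bar R) :
  (\esum_(l in [set: L]) ((twist_law l)%:E * F l) =
   \esum_(l in [set: L]) ((mu l)%:E * F (t l)))%E.
Proof.
rewrite (reindex_esum _ _ _ _ t_bij); apply: eq_esum => l _.
by rewrite /twist_law tK.
Qed.

Lemma twist_law_prob : is_prob mu -> is_prob twist_law.
Proof.
move=> [mu0 mu1]; split=> [l|]; first exact: mu0.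
rewrite -mu1 (reindex_esum _ _ _ _ t_bij); apply: eq_esum => l _.
by rewrite /twist_law tK.
Qed.

Lemma twist_law_generating : generating mu -> generating twist_law.
Proof.
move=> gmu S SM hS l.
rewrite -(tVK l); apply: (gmu [pred x | t x \in S]).
  by move=> x y; rewrite !inE tM; exact: SM.
by move=> x mux; rewrite inE; apply: hS; rewrite /twist_law tK.
Qed.

Lemma twist_walk dW (W : measurableType dW) (g : nat -> W -> L) k w : t 1%g = 1%g ->
  walk (fun i w => t (g i w)) k w = t (walk g k w).
Proof.
move=> t1; elim: k => [|k ih]; first by rewrite !walk0 t1.
by rewrite !walkS ih tM.
Qed.

Lemma twist_iid dW (W : measurableType dW) (P : probability W R) g :
  iid_of_law mu P g -> iid_of_law twist_law P (fun i w => t (g i w)).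
Proof.
move=> [mg Pg gI]; split=> [i A|i x|k A].
- exact: (mg i (t @^-1` A)).
- rewrite /twist_law -(Pg i); congr (P _).
  by apply/seteqP; split=> w /= => [<-|->].
- exact: (gI k (fun i => t @^-1` A i)).
Qed.

End twist.

Section twisted_power.
Context {R : realType} {L : groupType} {X : ptopologicalType}.
Variables (actX : L -> X -> X) (d : X -> X -> R).
Hypotheses (hX : is_Gspace actX) (hd : is_metric_for d).
Hypothesis cL : countable [set: L].
Variables (n : nat) (t tV : 'I_n -> L -> L).
Hypotheses (tK : forall i, cancel (t i) (tV i)) (tVK : forall i, cancel (tV i) (t i)).
Hypothesis tM : forall i l l', t i (l * l')%g = (t i l * t i l')%g.

Local Notation Y := (power n X).
Local Notation dY := (power_dist d).

Let t1 i : t i 1%g = 1%g.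
Proof. by apply: (mulgI (t i 1%g)); rewrite -tM !mulg1. Qed.

Definition twisted_act (l : L) (y : Y) : Y := fun i => actX (t i l) (y i).

Lemma twisted_Gspace : is_Gspace twisted_act.
Proof.
have [cX act1 actM actc] := hX; split.
- exact: power_compact.
- by move=> y; apply/funext => i; rewrite /twisted_act t1 act1.
- by move=> g h y; apply/funext => i; rewrite /twisted_act tM actM.
- move=> g; apply: continuous_to_power => i y.
  by apply: continuous_comp; [exact: power_proj_continuous|exact: actc].
Qed.

Lemma measurable_power_proj i : measurable_fun setT ((fun y : Y => y i) : borel Y -> borel X).
Proof.
apply: (@measurability _ _ _ (borel X) _ _ (@open X)) => //.
move=> _ [U oU <-]; rewrite setTI; apply: sub_sigma_algebra.
by move/continuousP : (@power_proj_continuous n X i) => /(_ _ oU).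
Qed.

Definition power_proj i : {mfun borel Y >-> borel X} :=
  HB.pack ((fun y : Y => y i) : borel Y -> borel X)
    (isMeasurableFun.Build _ _ _ _ _ (@measurable_power_proj i)).

Definition marginal (nu : probability (borel Y) R) i : probability (borel X) R :=
  distribution nu (power_proj i).

Lemma marginal_integral nu i (f : X -> R) : continuous f ->
  \int[marginal nu i]_x f x = \int[nu]_y f (y i).
Proof.
move=> cf; rewrite /Rintegral; congr fine.
rewrite [LHS](@integral_pushforward _ _ (borel Y) (borel X))//.
  exact: continuous_borel_EFin.
apply: (continuous_integrable twisted_Gspace nu (f := fun y => f (y i))) => y.
by apply: continuous_comp; [exact: power_proj_continuous|exact: cf].
Qed.

(** The i-th projection intertwines the action of [l] with that of [t i l], so the increments are
    pushed forward by [t i]. Hence mean-proximality is invoked for a possibly different law in each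
    coordinate. *)
Lemma marginal_stationary mu nu i : stationary twisted_act mu nu ->
  stationary actX (twist_law (tV i) mu) (marginal nu i).
Proof.
move=> hst A mA.
rewrite (twist_law_esum (tK i) (tVK i)).
have mA' : measurable ((fun y : Y => y i) @^-1` A : set (borel Y)).
  by rewrite -[_ @^-1` _]setTI; exact: measurable_power_proj.
by rewrite -[RHS](hst _ mA').
Qed.

Lemma power_cost nu l p : cost twisted_act dY nu l p =
  \sum_(i < n) cost actX d (marginal nu i) (t i l) (p i).
Proof.
have cY i : continuous (fun y : Y => d (actX (t i l) (y i)) (p i)).
  move=> y; apply: (@continuous_comp _ _ _ (fun y : Y => y i) (fun x => d (actX (t i l) x) (p i))).
    exact: power_proj_continuous.
  exact: (dist_act_continuous hX hd).
transitivity (\sum_(i < n) \int[nu]_y d (actX (t i l) (y i)) (p i)); last first.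
  by apply: eq_bigr => i _; rewrite /cost marginal_integral//; exact: (dist_act_continuous hX hd).
rewrite /cost /power_dist.
have h (r : seq 'I_n) : continuous (fun y : Y => \sum_(i <- r) d (actX (t i l) (y i)) (p i)).
  elim: r => [|j r ih].
    rewrite (_ : (fun _ => _) = cst 0); first exact: cst_continuous.
    by apply/funext => y; rewrite big_nil.
  rewrite (_ : (fun _ => _) = (fun y : Y => d (actX (t j l) (y j)) (p j) +
      \sum_(i <- r) d (actX (t i l) (y i)) (p i))); last first.
    by apply/funext => y; rewrite big_cons.
  by move=> y; apply: cvgD; [exact: cY|exact: ih].
elim: (index_enum _) => [|j r ih].
  rewrite big_nil; under eq_Rintegral do rewrite big_nil.
  by rewrite Rintegral_cst// mul0r.
rewrite big_cons -ih -RintegralD//; last 2 first.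
- exact: (continuous_integrable twisted_Gspace).
- exact: (continuous_integrable twisted_Gspace).
by apply: eq_Rintegral => y _; rewrite big_cons.
Qed.

End twisted_power.

Lemma cvg_sumr {R : realType} (I : Type) (r : seq I) (F : I -> nat -> R) (l : I -> R) :
  (forall i, F i k @[k --> \oo] --> l i) ->
  \sum_(i <- r) F i k @[k --> \oo] --> \sum_(i <- r) l i.
Proof.
move=> Fl; elim: r => [|j r ih].
  rewrite big_nil (_ : (fun _ => _) = cst 0); first exact: cvg_cst.
  by apply/funext => k; rewrite big_nil.
rewrite big_cons (_ : (fun _ => _) = (fun k => F j k + \sum_(i <- r) F i k)).
  exact: cvgD.
by apply/funext => k; rewrite big_cons.
Qed.

Section twisted_boundary.
Context {R : realType} {L : groupType} {X : ptopologicalType}.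
Variables (actX : L -> X -> X) (d : X -> X -> R).
Hypotheses (hX : is_Gspace actX) (hd : is_metric_for d).
Hypothesis cL : countable [set: L].
Variables (n : nat) (t tV : 'I_n -> L -> L).
Hypotheses (tK : forall i, cancel (t i) (tV i)) (tVK : forall i, cancel (tV i) (t i)).
Hypothesis tM : forall i l l', t i (l * l')%g = (t i l * t i l')%g.
Hypothesis hmp : forall mu : L -> R, is_prob mu -> generating mu ->
  exists nu : probability (borel X) R,
  [/\ stationary actX mu nu,
      forall nu' : probability (borel X) R, stationary actX mu nu' ->
        forall A : set (borel X), measurable A -> nu' A = nu A
    & is_boundary actX mu nu].
Variable mu : L -> R.
Hypotheses (hmu : is_prob mu) (gmu : generating mu).

Local Notation Y := (power n X).
Local Notation dY := (power_dist d).
Local Notation act := (twisted_act actX t).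
Let hY : is_Gspace act := twisted_Gspace hX tM.
Let hdY : is_metric_for dY := power_dist_metric n hd.

Let t1 i : t i 1%g = 1%g.
Proof. by apply: (mulgI (t i 1%g)); rewrite -tM !mulg1. Qed.

(* [phi l p] is the sum over i of the costs of the stationary measures of the
   twisted walks, and nu0 is the joint law of the n boundary points obtained by
   driving all the twisted walks with the same increments. *)
Lemma twisted_contraction : exists (phi : L -> Y -> R) (nu0 : probability (borel Y) R),
  [/\ stationary act mu nu0,
      forall nu, stationary act mu nu -> forall l p, cost act dY nu l p = phi l p
    & forall a : L -> Y, (forall l q, phi l (a l) <= phi l q) ->
        iter k (avg mu) (fun l => (phi l (a l))%:E) 1%g @[k --> \oo] --> 0%E].
Proof.
have [_ dC dT _] := hd.
have [_ _ actM _] := hX.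
have dge := dist_ge0 hd.
have hmu_ i := twist_law_prob (tK i) (tVK i) hmu.
have hi i := hmp (hmu_ i) (twist_law_generating (tK i) (tVK i) (@tM i) gmu).
have [nu_ hnu_] := choice hi.
pose phi l (p : Y) := \sum_(i < n) cost actX d (nu_ i) (t i l) (p i).
have phi_tri l p q : phi l p <= dY p q + phi l q.
  rewrite /phi /power_dist -big_split/=; apply: ler_sum => i _.
  exact: (cost_triangle hX hd).
have phi_dist l p q : dY p q <= phi l p + phi l q.
  rewrite /phi /power_dist -big_split/=; apply: ler_sum => i _.
  exact: (dist_cost hX hd).
have phi0 l p : 0 <= phi l p by apply: sumr_ge0 => i _; exact: cost_ge0.
have [B B0 hB] := cost_bound hX hd.
pose B' := \sum_(i < n) B.
have phiB l p : phi l p <= B' by apply: ler_sum => i _; exact: hB.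
have phiE nu : stationary act mu nu -> forall l p, cost act dY nu l p = phi l p.
  move=> hst l p; rewrite (power_cost hX hd tM).
  apply: eq_bigr => i _; rewrite /cost /Rintegral; congr fine.
  apply: eq_measure_integral => A mA _.
  have [_ huniq _] := hnu_ i.
  exact: (huniq _ (marginal_stationary tK tVK i hst) A mA).
have [P [g giid]] := exists_iid hmu cL.
have hae : {ae P, forall w, forall i, exists x : borel X, weak_star_cvg
    (fun k => translate actX (nu_ i) (t i (walk g k w))) \d_x}.
  apply: (@filter_forall _ _ (fun i w => exists x : borel X, weak_star_cvg
    (fun k => translate actX (nu_ i) (t i (walk g k w))) \d_x)) => i.
  have [_ _ hb] := hnu_ i.
  have := hb _ _ P _ (twist_iid (tV := tV i) (tK i) (tVK i) giid).
  apply: filterS => w [x hx]; exists x.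
  by under eq_fun do rewrite -(twist_walk (@tM i))//.
(* Naming one measurable null set [N] allows a limit point to be chosen for every path outside it
   and an arbitrary constant to be used on it. *)
have [N [mN N0 hN]] := hae.
have hb w : exists y : Y, ~ N w -> forall i, weak_star_cvg
    (fun k => translate actX (nu_ i) (t i (walk g k w))) (\d_(y i : borel X)).
  have [Nw|Nw] := pselect (N w); first by exists point.
  have /choice[y hy] : forall i, exists x : borel X, weak_star_cvg
    (fun k => translate actX (nu_ i) (t i (walk g k w))) \d_x.
    by apply: contrapT => h; apply: Nw; apply: hN.
  by exists y.
have [b {}hb] := choice hb.
(* The prefix [s] is needed for stationarity of the limit law, where a first step is put in front of
   the walk. The test function is the distance to [t i s] applied to the limit point, which vanishes
   at that point. *)
have key w s : ~ N w -> phi (s * walk g k w)%g (act s (b w)) @[k --> \oo] --> 0.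
  move=> Nw; rewrite /phi.
  suff : \sum_(i < n) cost actX d (nu_ i) (t i (s * walk g k w)%g) (act s (b w) i)
      @[k --> \oo] --> \sum_(i < n) (0 : R) by rewrite [X in _ --> X]big1.
  apply: cvg_sumr => i.
  pose f x := d (actX (t i s) x) (act s (b w) i).
  have cf : continuous f by exact: (@dist_act_continuous _ _ _ _ _ hX hd).
  have f0 : f (b w i) = 0 by have [h _ _ _] := hd; apply/h.
  have := weak_star_integral hX (hb w Nw i) cf; rewrite f0.
  apply: cvg_trans; apply: near_eq_cvg; apply: nearW => k.
  by rewrite /cost; apply: eq_Rintegral => x _; rewrite tM actM.
have key1 w : ~ N w -> phi (walk g k w) (b w) @[k --> \oo] --> 0.
  move=> Nw; have := key w 1%g Nw.
  have [_ -> _ _] := hY.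
  by under eq_fun do rewrite mul1g.
have [a0 ha0] := exists_argmin hY hdY phi_tri.
have contr (a : L -> Y) : (forall l q, phi l (a l) <= phi l q) ->
    iter k (avg mu) (fun l => (phi l (a l))%:E) 1%g @[k --> \oo] --> 0%E.
  move=> ha.
  have V0 l : (0 <= (phi l (a l))%:E)%E by rewrite lee_fin.
  under eq_fun do rewrite -(integral_walk hmu cL giid _ V0).
  rewrite -(integral0 P setT); apply: (bounded_cvg (c := B')).
  - by move=> k; apply: (measurable_walk cL giid k (fun l => (phi l (a l))%:E)).
  - exact: measurable_cst.
  - by move=> k w; rewrite !lee_fin phi0 phiB.
  - exists N; split => // w /= hw; apply: contrapT => Nw; apply: hw.
    apply/cvg_EFin; first exact: nearW.
    apply: (squeeze_cvgr _ (cvg_cst 0) (key1 w Nw)).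
    by apply: nearW => k; rewrite phi0 ha.
have key3 w s : ~ N w -> a0 (s * walk g k w)%g @[k --> \oo] --> act s (b w).
  move=> Nw; apply/(cvg_dist hdY).
  have h2 : phi (s * walk g k w)%g (act s (b w)) +
      phi (s * walk g k w)%g (act s (b w)) @[k --> \oo] --> (0 + 0 : R).
    by apply: cvgD; exact: key.
  rewrite addr0 in h2; apply: (squeeze_cvgr _ (cvg_cst 0) h2).
  apply: nearW => k; rewrite (dist_ge0 hdY)/=.
  by apply: le_trans (phi_dist _ _ _) _; apply: lerD => //; exact: ha0.
(* [b] comes from a choice, so its measurability is not automatic; outside [N] it is recovered as
   the limit of the minimisers [a0 (walk g k w)], which depend only on the position of the walk. *)
pose h k w : Y := if pselect (N w) then point else a0 (walk g k w).
pose h0 w : Y := if pselect (N w) then point else b w.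
have h0E w : ~ N w -> h0 w = b w by rewrite /h0; case: pselect.
have mh k (A : set Y) : measurable (h k @^-1` A).
  rewrite (_ : _ @^-1` _ = (N `&` [set _ | A point]) `|`
      (~` N `&` walk g k @^-1` (a0 @^-1` A))); last first.
    apply/seteqP; split=> w; rewrite /h/=; case: pselect => Nw //=.
    - by left.
    - by right.
    - by move=> [[]|[]].
    - by move=> [[]|[]].
  apply: measurableU; last first.
    by apply: measurableI; [exact: measurableC|exact: (walk_preimage cL giid)].
  apply: measurableI => //; have [Ap|Ap] := pselect (A point).
    by rewrite (_ : [set _ | _] = setT); [exact: measurableT|apply/seteqP; split].
  by rewrite (_ : [set _ | _] = set0); [exact: measurable0|apply/seteqP; split].
have mh0 : measurable_fun setT (h0 : _ -> borel Y).
  apply: (measurable_discrete_limit hdY mh) => w; rewrite /h /h0.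
  case: pselect => Nw /=; first exact: cvg_cst.
  have := key3 w 1%g Nw; have [_ -> _ _] := hY.
  by under eq_fun do rewrite mul1g.
pose b_ : {mfun _ >-> borel Y} := HB.pack (h0 : measurableTypeR R -> borel Y)
  (isMeasurableFun.Build _ _ _ _ _ mh0).
pose nu0 : probability (borel Y) R := distribution P b_.
exists phi, nu0; split => //.
pose A_ s : {mfun borel Y >-> borel Y} :=
  HB.pack (act s : borel Y -> borel Y) (isMeasurableFun.Build _ _ _ _ _ (@act_borel _ _ _ hY s)).
have [m [mE mint]] := mixture (1%g : L) (fun s => distribution nu0 (A_ s)) cL hmu.1.
have m1 : m setT = 1%E.
  rewrite mE -hmu.2; apply: eq_esum => s _.
  by rewrite [X in (_ * X)%E](probability_setT (distribution nu0 (A_ s))) mule1.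
suff st A : measurable A -> nu0 A = mk_probability m1 A.
  by move=> A mA; rewrite st// mk_probabilityE mE.
apply: (borel_measure_unique hdY) => f C C0 f01 fC.
have cf := lipschitz_continuous hdY fC.
have f0 y : 0 <= f y by have /andP[] := f01 y.
have mf (F : Y -> R) : continuous F ->
    measurable_fun setT (fun w => (F (h0 w))%:E).
  move=> cF; apply: (measurableT_comp (f := fun y : borel Y => (F y)%:E)) => //.
  exact: continuous_borel_EFin.
pose q s := (\int[P]_w (f (act s (h0 w)))%:E)%E.
have nu0int (F : Y -> R) : continuous F -> (forall y, 0 <= F y) ->
    (\int[nu0]_y (F y)%:E = \int[P]_w (F (h0 w))%:E)%E.
  move=> cF F0; rewrite ge0_integral_distribution//.
  exact: continuous_borel_EFin.
have -> : (\int[nu0]_y (f y)%:E = q 1%g)%E.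
  rewrite nu0int// /q; apply: eq_integral => w _.
  by have [_ -> _ _] := hY.
have -> : (\int[mk_probability m1]_y (f y)%:E = avg mu q 1%g)%E.
  rewrite (eq_measure_integral m)//.
  rewrite mint; last 2 first.
  - exact: continuous_borel_EFin.
  - by move=> y; rewrite lee_fin.
  apply: eq_esum => s _; rewrite mul1g; congr (_ * _)%E.
  rewrite ge0_integral_pushforward//.
    rewrite /q -(nu0int (fun y => f (act s y)))//.
    exact: (continuous_act hY).
  exact: continuous_borel_EFin.
  by move=> y _ /=; rewrite lee_fin.
(* Since [a0 (s * walk g k w)] tends to [act s (b w)], the iterates of [avg] on [u] tend to [q].
   Shifting the index by one shows that [q] equals its average at 1, which is stationarity tested on
   [f]. *)
pose u l := (f (a0 l))%:E.
have u0 l : (0 <= u l)%E by rewrite lee_fin.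
have u1 k l : (0 <= iter k (avg mu) u l <= 1%:E)%E.
  rewrite iter_avg_ge0//= -[leRHS](iter_avg_cst hmu k l (c := 1%:E))//.
  by apply: le_iter_avg => // l'; rewrite lee_fin; have /andP[] := f01 (a0 l').
have uq s : iter k (avg mu) u s @[k --> \oo] --> q s.
  have us k : iter k (avg mu) u s = (\int[P]_w u (s * walk g k w)%g)%E.
    rewrite (integral_walk hmu cL giid k (u := fun l => u (s * l)%g))//.
    by rewrite iter_avg_shift mulg1.
  under eq_fun do rewrite us.
  apply: (bounded_cvg (c := 1)).
  - by move=> k; apply: (measurable_walk cL giid k (fun l => u (s * l)%g)).
  - apply: (mf (fun y => f (act s y))); exact: (continuous_act hY).
  - by move=> k w; rewrite !lee_fin.
  - exists N; split => // w /= hw; apply: contrapT => Nw; apply: hw.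
    rewrite h0E//; apply/cvg_EFin; first exact: nearW.
    exact: (cvg_comp _ _ (key3 w s Nw) (cf _)).
have h1 := avg_cvg hmu cL (g := 1%g) u1 uq.
have h2 : iter k.+1 (avg mu) u 1%g @[k --> \oo] --> q 1%g.
  by rewrite (cvg_shiftS (fun k => iter k (avg mu) u 1%g)); exact: uq.
exact: (cvg_unique (@ereal_hausdorff R) h2 h1).
Qed.
End twisted_boundary.

Lemma esum_disjoint_bigcup {R : realType} (I T : choiceType) (J : I -> set T)
    (a : T -> \bar R) : trivIset [set: I] J -> (forall x, 0 <= a x)%E ->
  (\esum_(x in \bigcup_i J i) a x = \esum_(i in [set: I]) \esum_(x in J i) a x)%E.
Proof.
move=> tJ a0; rewrite esum_esum//.
apply: (reindex_esum _ _ (fun k : I * T => k.2)); split.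
- by move=> [i x] [/= _ Jx]; exists i.
- move=> [i x] [j y]; rewrite !inE /= => -[_ Jx] [_ Jy] xy.
  rewrite -xy in Jy *; congr pair; apply: tJ => //.
  by exists x.
- by move=> x [i _ Jx]; exists (i, x).
Qed.

Lemma adde_cancel {R : realType} (x a b : \bar R) : x \is a fin_num ->
  (x + a = x + b -> a = b)%E.
Proof.
by move=> fx ab; rewrite -(addeK a fx) (addeC a) ab (addeC x) addeK.
Qed.

(** * First return to a subgroup of finite index *)

Lemma finite_index_cosets (G : groupType) (S : {pred G}) :
  group_closed S -> finite_index S ->
  exists (n : nat) (r : 'I_n -> G) (c : G -> 'I_n),
    [/\ forall g h, c g = c h <-> (g^-1 * h)%g \in S & forall i, c (r i) = i].
Proof.
move=> gS; have [S1 SB] := gS; have SM := group_closedM gS; have SV := group_closedV gS.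
pose coset g := [set (g * s)%g | s in [set` S]].
have cosetE g h : coset g = coset h <-> (g^-1 * h)%g \in S.
  split=> [gh|ghS].
    have : coset g h by rewrite gh; exists 1%g => //; rewrite mulg1.
    by move=> [s /= sS <-]; rewrite mulKg.
  apply/seteqP; split=> _ [s /= sS <-].
    exists ((g^-1 * h)^-1 * s)%g; first by apply: SM => //; exact: SV.
    by rewrite invgM invgK !mulgA mulgV mul1g.
  by exists ((g^-1 * h) * s)%g; [exact: SM|rewrite !mulgA mulgV mul1g].
move=> /finite_seqP[F FE].
pose e : seq (set G) := undup F.
have inF g : coset g \in e.
  by rewrite mem_undup; have : [set` F] (coset g) by rewrite -FE; exists g.
have nthF (i : 'I_(size e)) : exists g, coset g = nth set0 e i.
  have : [set` F] (nth set0 e i) by rewrite /= -mem_undup; exact: mem_nth.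
  by rewrite -FE => -[g _ <-]; exists g.
have [r hr] := choice nthF.
have idx g : (index (coset g) e < size e)%N by rewrite index_mem.
exists (size e), r, (fun g => Ordinal (idx g)); split.
  move=> g h; rewrite -cosetE; split=> [[]|gh].
    move=> gh; rewrite -(nth_index set0 (inF g)) -(nth_index set0 (inF h)).
    by congr nth.
  by apply: val_inj => /=; rewrite gh.
by move=> i; apply: val_inj => /=; rewrite hr index_uniq// undup_uniq.
Qed.

Section words.
Context {R : realType} {G : groupType} (mu : G -> R) (hmu : is_prob mu).
Variables (S : {pred G}) (n : nat) (c : G -> 'I_n).
Hypothesis gS : group_closed S.
Hypothesis cE : forall g h, c g = c h <-> (g^-1 * h)%g \in S.

Let S1 : 1%g \in S. Proof. by case: gS. Qed.
Let SM := group_closedM gS.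
Let SV := group_closedV gS.

Local Notation wt := (weight mu).
Let wt0 w : 0 <= wt w := weight_ge0 hmu w.
Local Open Scope ereal_scope.
Let wtE0 w : 0 <= (wt w)%:E. Proof. by rewrite lee_fin. Qed.

(* [ext s w] adds the letter s to the word w, on the right or on the left, and
   [T] is the set of words which have never returned to S. *)
Section excursions.
Variables (ext : G -> seq G -> seq G) (T : set (seq G)).
Hypothesis ext_inj : forall s s' w w', ext s w = ext s' w' -> s = s' /\ w = w'.
Hypothesis ext_surj : forall v, v <> [::] -> exists s w, v = ext s w.
Hypothesis ext_size : forall s w, size (ext s w) = (size w).+1.
Hypothesis ext_weight : forall s w, wt (ext s w) = (wt w * mu s)%R.
Hypothesis T_nil : T [::].
Hypothesis T_ext : forall s w, T (ext s w) <-> T w /\ wprod (ext s w) \notin S.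
Hypothesis ext_coset : forall g s, exists g', forall w,
  c (wprod (ext s w)) = c g <-> c (wprod w) = c g'.

Definition return_words : set (seq G) :=
  [set v | exists s w, [/\ v = ext s w, T w & wprod v \in S]].

Let ext_neq0 s w : ext s w <> [::].
Proof. by move=> h; have := ext_size s w; rewrite h. Qed.

(** The balance equation of an excursion: one more letter turns a word that has not returned either
    into a nonempty word that has not returned or into a return word, and each of these arises
    exactly once. *)
Lemma esum_ext (F : seq G -> \bar R) : (forall v, 0 <= F v) ->
  \esum_(w in T) \esum_(s in [set: G]) F (ext s w) =
  \esum_(v in T `\ [::]) F v + \esum_(v in return_words) F v.
Proof.
move=> F0; rewrite esum_esum//.
pose U := (T `\ [::]) `|` return_words.
have UE : set_bij (T `*`` (fun=> [set: G])) U (fun k => ext k.2 k.1).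
  split=> [[w s] [/= Tw _]|[w s] [w' s'] _ _ /= /ext_inj[-> ->]//|v].
    have [iS|iS] := boolP (wprod (ext s w) \in S).
      by right; exists s, w.
    by left; split; [apply/T_ext|exact: ext_neq0].
  move=> [[Tv v0]|[s [w [-> Tw _]]]]; last by exists (w, s).
  have [s [w vE]] := ext_surj v0.
  by exists (w, s) => //; move: Tv; rewrite vE => /T_ext[].
rewrite -(reindex_esum _ _ _ F UE).
rewrite (esumID T)//; congr (_ + _); congr (esum _ _); apply/seteqP; split=> v.
- move=> [[[Tv v0]|[s [w [-> Tw sS]]]] Tv'] //.
  by move/T_ext : Tv' => [_]; rewrite sS.
- by move=> [Tv v0]; split => //; left.
- by move=> [[[Tv v0]|//] Tv'].
- move=> [s [w [-> Tw sS]]]; split; first by right; exists s, w.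
  by move=> /T_ext[_]; rewrite sS.
Qed.

Lemma esum_T_nil (F : seq G -> \bar R) : (forall v, 0 <= F v) ->
  \esum_(v in T) F v = F [::] + \esum_(v in T `\ [::]) F v.
Proof.
move=> F0; rewrite (esumID [set [::]])//; congr (_ + _).
rewrite (_ : T `&` _ = [set [::]]) ?esum_set1//.
by apply/seteqP; split=> [v []//|v ->].
Qed.

(* The counting measure on the finite set of cosets is stationary, hence the
   bound 1 on the expected number of visits before the first return. *)
Lemma coset_visits k g :
  \esum_(w in T `&` [set w | (size w <= k)%N /\ c (wprod w) = c g]) (wt w)%:E <= 1.
Proof.
elim: k g => [|k ih] g.
  apply: (@le_trans _ _ (\esum_(w in [set [::]]) (wt w)%:E)).
    by apply: le_esum_subset => w [_ [/=]]; rewrite leqn0 => /eqP/size0nil ->.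
  by rewrite esum_set1// /weight big_nil.
have T1 w : T w -> wprod w \in S -> w = [::].
  move=> Tw wS; apply: contrapT => /ext_surj[s [w' wE]].
  by move: Tw wS; rewrite wE => /T_ext[_ /negP].
have [g1|g1] := pselect (c g = c 1%g).
  apply: (@le_trans _ _ (\esum_(w in [set [::]]) (wt w)%:E)).
    apply: le_esum_subset => w [Tw [_ wg]]; apply: T1 => //.
    by have /cE := etrans wg g1; rewrite mulg1 => /SV; rewrite invgK.
  by rewrite esum_set1// /weight big_nil.
apply: (@le_trans _ _ (\esum_(s in [set: G]) ((mu s)%:E * 1))); last first.
  by under eq_esum do rewrite mule1; rewrite hmu.2.
(* Removing the letter [s] moves the visit from the coset of [g] to that of [h s], where the
   induction hypothesis bounds the visits by 1. *)
have [h hh] := choice (ext_coset g).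
pose A s := T `&` [set w | (size w <= k)%N /\ c (wprod w) = c (h s)].
apply: (@le_trans _ _ (\esum_(s in [set: G]) \esum_(w in A s) (wt (ext s w))%:E)); last first.
  apply: le_esum => s _; under eq_esum do rewrite ext_weight mulrC EFinM.
  rewrite esumZl//; last exact: (hmu.1).
  by apply: lee_wpmul2l; [rewrite lee_fin; apply hmu.1|exact: ih].
rewrite esum_esum//.
rewrite -(esum_image _ (fun k => ext k.1 k.2) (fun w => (wt w)%:E)); last first.
  by move=> [s w] [s' w'] _ _ /= /ext_inj[-> ->].
apply: le_esum_subset => w [Tw [wk wg]].
have w0 : w <> [::].
  by move=> w0; apply: g1; rewrite -wg w0 /wprod big_nil.
have [s [w' wE]] := ext_surj w0.
rewrite wE in Tw wk wg *.
exists (s, w') => //; split=> //=; split; first by case/T_ext: Tw.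
by split; [move: wk; rewrite ext_size|apply/hh].
Qed.

(** At most one expected visit to each of the [n] cosets. A finite partial sum involves words of
    bounded length, so the bounds of [coset_visits] suffice. *)
Lemma excursion_finite : \esum_(w in T) (wt w)%:E <= n%:R%:E.
Proof.
have h (i : 'I_n) : \esum_(w in T `&` [set w | c (wprod w) = i]) (wt w)%:E <= 1.
  apply: ge_ereal_sup => _ /= [X [finX XT] <-].
  have [g0|ng] := pselect (exists g, c g = i); last first.
    rewrite (_ : X = set0) ?fsbig_set0//.
    by apply/seteqP; split=> // w /XT[_ /= wi]; apply: ng; exists (wprod w).
  have [g gi] := g0.
  have [k hk] : exists k, forall w, X w -> (size w <= k)%N.
    have [F XF] := (finite_seqP X).1 finX.
    exists (\max_(w <- F) size w)%N => w; rewrite XF /= => wF.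
    by rewrite (big_rem w)//= leq_maxl.
  apply: le_trans (coset_visits k g).
  rewrite -esum_fset//.
  apply: le_esum_subset => w Xw; have [Tw wi] := XT _ Xw; split => //; split.
    exact: hk.
  by rewrite gi.
rewrite (eq_esum (b := fun w => \sum_(i < n) if c (wprod w) == i then (wt w)%:E else 0)); last first.
  by move=> w _; rewrite -big_mkcond/= (big_pred1 (c (wprod w))).
rewrite esum_sum; last by move=> w i _ _; case: ifP.
apply: (@le_trans _ _ (\sum_(i < n) 1%E)); last first.
  by rewrite sumEFin sumr_const card_ord.
apply: lee_sum => i _; apply: le_trans (h i).
rewrite esum_mkcondr; apply: le_esum => w _; case: ifP => [/eqP wi|_].
  by rewrite mem_set.
by case: ifP.
Qed.

(** Adding a letter of law [mu] preserves mass. In the balance equation the nonempty words of [T]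
    have finite mass and cancel, which leaves the mass 1 of the empty word; so finiteness of the
    expected return time yields recurrence. *)
Lemma return_words_mass : \esum_(v in return_words) (wt v)%:E = 1.
Proof.
have fT : \esum_(v in T) (wt v)%:E \is a fin_num.
  by rewrite ge0_fin_numE ?esum_ge0// (le_lt_trans excursion_finite)// ltry.
have h := esum_ext wtE0.
have hT : \esum_(w in T) \esum_(s in [set: G]) (wt (ext s w))%:E = \esum_(v in T) (wt v)%:E.
  apply: eq_esum => w _.
  rewrite -[RHS]mule1 -hmu.2 -esumZl//; last by move=> i; rewrite lee_fin; apply hmu.1.
  by apply: eq_esum => s _; rewrite ext_weight EFinM.
move: h; rewrite hT {1}(esum_T_nil wtE0) [LHS]addeC.
have fT' : \esum_(v in T `\ [::]) (wt v)%:E \is a fin_num.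
  move: fT; rewrite !ge0_fin_numE ?esum_ge0//; apply: le_lt_trans.
  by apply: le_esum_subset => v [].
move=> eT; rewrite -(adde_cancel fT' eT).
by rewrite /weight big_nil.
Qed.

End excursions.

(** Right excursions follow the walk and serve harmonic functions; left excursions serve measures,
    since translating by a further group element puts a letter in front. *)
Definition right_excursion : set (seq G) :=
  [set w | forall i, (0 < i <= size w)%N -> wprod (take i w) \notin S].

Definition left_excursion : set (seq G) :=
  [set w | forall i, (i < size w)%N -> wprod (drop i w) \notin S].

Lemma right_excursion_nil : right_excursion [::].
Proof. by move=> [|i]. Qed.

Lemma left_excursion_nil : left_excursion [::].
Proof. by []. Qed.

Lemma right_excursion_rcons s w : right_excursion (rcons w s) <->
  right_excursion w /\ wprod (rcons w s) \notin S.
Proof.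
split=> [h|[h hs] i].
  split; last first.
    by have := h (size (rcons w s)); rewrite take_size; apply; rewrite size_rcons leqnn.
  move=> i /andP[i0 iw]; have := h i; rewrite size_rcons -cats1 takel_cat//; apply.
  by rewrite i0 ltnW.
rewrite size_rcons => /andP[i0]; rewrite leq_eqVlt => /predU1P[->|iw].
  by rewrite -(size_rcons w s) take_size.
by rewrite -cats1 takel_cat//; apply: h; rewrite i0.
Qed.

Lemma left_excursion_cons s w : left_excursion (s :: w) <->
  left_excursion w /\ wprod (s :: w) \notin S.
Proof.
split=> [h|[h hs] [|i] iw]; last 2 first.
- by rewrite drop0.
- exact: h.
split; last by have := h 0%N; rewrite drop0; apply.
by move=> i iw; exact: (h i.+1).
Qed.

Lemma wprod_cons (s : G) (w : seq G) : wprod (s :: w) = (s * wprod w)%g.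
Proof. by rewrite /wprod big_cons. Qed.

Lemma wprod_cat (v w : seq G) : wprod (v ++ w) = (wprod v * wprod w)%g.
Proof. by rewrite /wprod big_cat. Qed.

Lemma weight_cons (s : G) (w : seq G) : wt (s :: w) = (wt w * mu s)%R.
Proof. by rewrite /weight big_cons mulrC. Qed.

Local Notation right_ext := (fun s w => rcons w s).
Local Notation left_ext := (fun s w => s :: w).

(* When the whole product is in S, a prefix is in S iff the complementary
   suffix is; so both walks have the same first return law. *)
Lemma right_left_return : return_words right_ext right_excursion =
  return_words left_ext left_excursion.
Proof.
have TD v i : wprod v \in S -> (wprod (take i v) \in S) = (wprod (drop i v) \in S).
  move=> vS; move: (vS); rewrite -{1}(cat_take_drop i v) wprod_cat => h.
  apply/idP/idP => h'.
    rewrite -(mulKg (wprod (take i v)) (wprod (drop i v))).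
    by apply: SM => //; exact: SV.
  rewrite -(mulgK (wprod (drop i v)) (wprod (take i v))).
  by apply: SM => //; exact: SV.
apply/seteqP; split=> v [s [w [vE Tw vS]]].
  case: v vE vS => [|a v] vE vS; first by move/(congr1 size): vE; rewrite size_rcons.
  exists a, v; split => // i iv.
  rewrite -[drop i v]/(drop i.+1 (a :: v)) -TD// vE -cats1 takel_cat.
    by apply: Tw; move/(congr1 size): vE; rewrite /= size_rcons => -[<-].
  by move/(congr1 size): vE; rewrite /= size_rcons => -[<-].
case/lastP: v vE vS => [//|v a] vE vS.
have vw : size v = size w by move/(congr1 size): vE; rewrite /= size_rcons => -[].
exists a, v; split => // -[//|i] /andP[_ iv].
rewrite -(takel_cat [:: a])// cats1 TD// vE /=.
by apply: Tw; rewrite -vw.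
Qed.

Hypothesis nS : normal_in S.

Let right_inj (s s' : G) (w w' : seq G) : rcons w s = rcons w' s' -> s = s' /\ w = w'.
Proof. by move=> /rcons_inj[-> ->]. Qed.

Let right_surj (v : seq G) : v <> [::] -> exists s w, v = rcons w s.
Proof. by case/lastP: v => // w s _; exists s, w. Qed.

Let right_size (s : G) (w : seq G) : size (rcons w s) = (size w).+1.
Proof. exact: size_rcons. Qed.

Let right_weight (s : G) (w : seq G) : wt (rcons w s) = (wt w * mu s)%R.
Proof. exact: weight_rcons. Qed.

(** Right multiplication by [s] permutes the left cosets because [S] is normal. *)
Let right_coset (g s : G) : exists g', forall w,
  c (wprod (rcons w s)) = c g <-> c (wprod w) = c g'.
Proof.
exists (g * s^-1)%g => w; rewrite !cE wprod_rcons invgM.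
split=> h.
  have := @nS _ s^-1%g h; rewrite /conjg invgK; congr (_ \in S).
  by rewrite !mulgA mulgV mul1g.
have := @nS _ s h; rewrite /conjg; congr (_ \in S).
by rewrite !mulgA mulgVK.
Qed.

Let left_inj (s s' : G) (w w' : seq G) : s :: w = s' :: w' -> s = s' /\ w = w'.
Proof. by move=> [-> ->]. Qed.

Let left_surj (v : seq G) : v <> [::] -> exists s w, v = s :: w.
Proof. by case: v => // s w _; exists s, w. Qed.

Let left_size (s : G) (w : seq G) : size (s :: w) = (size w).+1.
Proof. by []. Qed.

Let left_coset (g s : G) : exists g', forall w,
  c (wprod (s :: w)) = c g <-> c (wprod w) = c g'.
Proof.
by exists (s^-1 * g)%g => w; rewrite !cE wprod_cons invgM mulgA.
Qed.

Definition first_return := return_words left_ext left_excursion.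

Lemma first_return_mass : \esum_(v in first_return) (wt v)%:E = 1.
Proof.
exact: (return_words_mass left_inj left_surj left_size weight_cons
  left_excursion_nil left_excursion_cons left_coset).
Qed.

Lemma left_excursion_esum (F : seq G -> \bar R) : (forall v, 0 <= F v) ->
  F [::] + \esum_(w in left_excursion) \esum_(s in [set: G]) F (s :: w) =
  \esum_(v in left_excursion) F v + \esum_(v in first_return) F v.
Proof.
move=> F0; rewrite (esum_ext left_inj left_surj left_size left_excursion_cons F0).
by rewrite (esum_T_nil left_excursion_nil F0) addeA.
Qed.

Lemma right_excursion_esum (F : seq G -> \bar R) : (forall v, 0 <= F v) ->
  F [::] + \esum_(w in right_excursion) \esum_(s in [set: G]) F (rcons w s) =
  \esum_(v in right_excursion) F v + \esum_(v in first_return) F v.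
Proof.
move=> F0; rewrite /first_return -right_left_return.
rewrite (esum_ext right_inj right_surj right_size right_excursion_rcons F0).
by rewrite (esum_T_nil right_excursion_nil F0) addeA.
Qed.

Lemma right_excursion_mass : \esum_(w in right_excursion) (wt w)%:E <= n%:R%:E.
Proof.
exact: (excursion_finite right_inj right_surj right_size right_weight
  right_excursion_rcons right_coset).
Qed.

Lemma left_excursion_mass : \esum_(w in left_excursion) (wt w)%:E <= n%:R%:E.
Proof.
exact: (excursion_finite left_inj left_surj left_size weight_cons
  left_excursion_cons left_coset).
Qed.

(* Optional stopping at the first return to S. *)
Lemma harmonic_first_return (f : G -> R) (B : R) :
  (forall g, 0 <= f g <= B)%R -> avg mu (EFin \o f) = EFin \o f ->
  \esum_(v in first_return) ((wt v)%:E * (f (wprod v))%:E) = (f 1%g)%:E.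
Proof.
move=> fB hf.
have f0 g : (0 <= f g)%R by have /andP[] := fB g.
pose F v := (wt v)%:E * (f (wprod v))%:E.
have F0 v : 0 <= F v by rewrite mule_ge0// lee_fin.
have := right_excursion_esum F0.
have -> : \esum_(w in right_excursion) \esum_(s in [set: G]) F (rcons w s) =
    \esum_(w in right_excursion) F w.
  apply: eq_esum => w _; rewrite /F.
  rewrite (_ : (f (wprod w))%:E = avg mu (EFin \o f) (wprod w)); last by rewrite hf.
  rewrite /avg -esumZl//; last first.
    by move=> s; apply: mule_ge0; rewrite lee_fin; [apply hmu.1|exact: f0].
  by apply: eq_esum => s _; rewrite weight_rcons wprod_rcons EFinM muleA.
rewrite [LHS]addeC => eF; rewrite -(adde_cancel _ eF).
  by rewrite /F /weight /wprod !big_nil mul1e.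
rewrite ge0_fin_numE ?esum_ge0//.
apply: (@le_lt_trans _ _ (B%:E * \esum_(w in right_excursion) (wt w)%:E)).
  have B0 : (0 <= B)%R by have /andP[h1 h2] := fB 1%g; exact: le_trans h1 h2.
  rewrite -esumZl//; apply: le_esum => w _; rewrite /F muleC.
  by apply: lee_wpmul2r => //; rewrite lee_fin; have /andP[] := fB (wprod w).
apply: (@le_lt_trans _ _ (B%:E * n%:R%:E)); last by rewrite ltry.
apply: lee_wpmul2l; last exact: right_excursion_mass.
by rewrite lee_fin; have /andP[h1 h2] := fB 1%g; exact: le_trans h1 h2.
Qed.

Variable L : subGroupType S.

Definition return_law (l : L) : R :=
  fine (\esum_(v in first_return `&` [set v | wprod v = val l]) (wt v)%:E).

Let return_lawE (l : L) : (return_law l)%:E =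
  \esum_(v in first_return `&` [set v | wprod v = val l]) (wt v)%:E.
Proof.
rewrite /return_law fineK// ge0_fin_numE ?esum_ge0//.
apply: (@le_lt_trans _ _ 1); last by rewrite ltry.
by rewrite -first_return_mass; apply: le_esum_subset => v [].
Qed.

Lemma return_law_esum (f : G -> R) : (forall g, 0 <= f g)%R ->
  \esum_(l in [set: L]) ((return_law l)%:E * (f (val l))%:E) =
  \esum_(v in first_return) ((wt v)%:E * (f (wprod v))%:E).
Proof.
move=> f0.
pose J (l : L) := first_return `&` [set v | wprod v = val l].
rewrite (_ : first_return = \bigcup_(l in [set: L]) J l); last first.
  apply/seteqP; split=> v; last by move=> [l _ []].
  move=> rv; have vS : wprod v \in S by move: rv => [s [w []]].
  by exists (Sub (wprod v) vS : L) => //; split => //=; rewrite SubK.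
rewrite esum_disjoint_bigcup; last 2 first.
- apply/trivIsetP => l l' _ _ ll'; apply/seteqP; split=> // v [[_ /= vl] [_ /= vl']].
  by move/eqP: ll'; apply; apply: val_inj; rewrite -vl -vl'.
- by move=> v; rewrite mule_ge0// lee_fin.
apply: eq_esum => l _; rewrite return_lawE -esumZr//.
by apply: eq_esum => v [_ /= ->].
Qed.

Lemma return_law_ge0 l : (0 <= return_law l)%R.
Proof. by apply: fine_ge0; exact: esum_ge0. Qed.

Lemma return_law_prob : is_prob return_law.
Proof.
split=> [l|]; first exact: return_law_ge0.
rewrite -first_return_mass.
transitivity (\esum_(l in [set: L]) ((return_law l)%:E * ((fun=> 1%R) (val l))%:E)).
  by apply: eq_esum => l _; rewrite mule1.
rewrite (return_law_esum (f := fun=> 1%R))//.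
by apply: eq_esum => v _; rewrite mule1.
Qed.

(** Left translates of harmonic functions are harmonic, so optional stopping from 1 applies to the
    translate of [f] by [l]. *)
Lemma return_law_harmonic (f : G -> R) (B : R) :
  (forall g, 0 <= f g <= B)%R -> avg mu (EFin \o f) = EFin \o f ->
  avg return_law (fun l => (f (val l))%:E) = (fun l => (f (val l))%:E).
Proof.
move=> fB hf; apply/funext => l.
have f0 g : (0 <= f g)%R by have /andP[] := fB g.
pose fl g := f (val l * g)%g.
rewrite -[in RHS](mulg1 (val l)) -/(fl 1%g).
rewrite -(@harmonic_first_return fl B)//; last 2 first.
- by move=> g; exact: fB.
- apply/funext => g.
  rewrite (avg_shift mu (EFin \o f) (val l) g).
  by rewrite hf.
rewrite -return_law_esum; last by move=> g; exact: f0.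
by apply: eq_esum => l' _; rewrite valM.
Qed.

(** Write [l] as the product of a word in the support of [mu] and cut the word at its successive
    visits to [S]: each piece is a first return word of positive weight, so its product lies in
    [T]. *)
Lemma return_law_generating : generating mu -> generating return_law.
Proof.
move=> gmu T TM Tpos l.
pose pos (w : seq G) := forall x, x \in w -> (0 < mu x)%R.
have posM v w : pos v -> pos w -> pos (v ++ w).
  by move=> hv hw x; rewrite mem_cat => /orP[]; [exact: hv|exact: hw].
have wt_pos w : pos w -> (0 < wt w)%R.
  elim: w => [|s w ih] hw; first by rewrite /weight big_nil.
  rewrite weight_cons mulr_gt0//; last by apply: hw; rewrite inE eqxx.
  by apply: ih => x xw; apply: hw; rewrite inE xw orbT.
have hT v (l' : L) : first_return v -> pos v -> wprod v = val l' -> l' \in T.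
  move=> rv pv vl; apply: Tpos; rewrite -lte_fin return_lawE.
  apply: (@lt_le_trans _ _ (wt v)%:E); first by rewrite lte_fin wt_pos.
  apply: esum_ge; exists [set v]; last by rewrite fsbig_set1.
  by split=> // _ ->.
(* The word has to be nonempty: [T] is closed under products but is not assumed to contain 1. *)
have [w [w0 pw wl]] : exists w, [/\ w <> [::], pos w & wprod w = val l].
  pose S' : {pred G} := [pred g | `[< exists w, [/\ w <> [::], pos w & wprod w = g] >]].
  suff : val l \in S' by move=> /asboolP.
  apply: gmu => [g h /asboolP[v [v0 pv <-]] /asboolP[w [w0 pw <-]]|g mug].
    apply/asboolP; exists (v ++ w); split; [by case: v v0 {pv}|exact: posM|exact: wprod_cat].
  apply/asboolP; exists [:: g]; split=> //; last by rewrite /wprod big_seq1.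
  by move=> x; rewrite inE => /eqP ->.
(* [t] is the product of the completed returns and [v] the excursion in progress; the last
   alternative says that no return has occurred yet. *)
have inv u : pos u -> u <> [::] -> exists (t : G) (v : seq G),
    [/\ wprod u = (t * wprod v)%g, right_excursion v, pos v &
     (exists2 l', l' \in T & val l' = t) \/ (t = 1%g /\ v <> [::])].
  elim/last_ind: u => [//|u s ih] pu _.
  have pu' : pos u by move=> x xu; apply: pu; rewrite mem_rcons inE xu orbT.
  have ps : pos [:: s].
    by move=> x; rewrite inE => /eqP ->; apply: pu; rewrite mem_rcons inE eqxx.
  have [t [v [uE Ev pv tv]]] : exists (t : G) (v : seq G),
    [/\ wprod u = (t * wprod v)%g, right_excursion v, pos v &
     (exists2 l', l' \in T & val l' = t) \/ t = 1%g].
    have [u0|u0] := pselect (u = [::]).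
      exists 1%g, [::]; split=> //; [by rewrite u0 mul1g|exact: right_excursion_nil|by right].
    have [t [v [h1 h2 h3 h4]]] := ih pu' u0; exists t, v; split => //.
    by case: h4 => [h4|[h4 _]]; [left|right].
  have pvs : pos (rcons v s) by rewrite -cats1; exact: posM.
  have uvE : wprod (rcons u s) = (t * wprod (rcons v s))%g.
    by rewrite !wprod_rcons uE mulgA.
  have [vS|vS] := boolP (wprod (rcons v s) \in S); last first.
    exists t, (rcons v s); split => //; first exact/right_excursion_rcons.
    by case: tv => [?|?]; [left|right; split => //; case: (v)].
  have rv : first_return (rcons v s).
    by rewrite /first_return -right_left_return; exists s, v.
  pose l' : L := Sub (wprod (rcons v s)) vS.
  have l'E : val l' = wprod (rcons v s) by rewrite SubK.
  have l'T : l' \in T by apply: (hT _ _ rv).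
  exists (wprod (rcons u s)), [::]; split.
  - by rewrite [wprod [::]]/wprod big_nil mulg1.
  - exact: right_excursion_nil.
  - by [].
  left; case: tv => [[l1 l1T l1t]|t1].
    by exists (l1 * l')%g; [exact: TM|rewrite valM l'E l1t -uvE].
  by exists l' => //; rewrite uvE t1 mul1g.
have [t [v [uE Ev pv tv]]] := inv w pw w0.
have vE : wprod v \in S -> v = [::].
  move=> vS; apply: contrapT => v0; have := Ev (size v).
  by rewrite leqnn take_size vS andbT lt0n size_eq0 => /(_ (introN eqP v0)).
case: tv => [[l' l'T l't]|[t1 v0]].
  have vS : wprod v \in S.
    rewrite -(mulKg t (wprod v)) -uE wl; apply: SM; last exact: valP.
    by apply: SV; rewrite -l't; exact: valP.
  suff -> : l = l' by [].
  apply: val_inj; rewrite -wl uE (vE vS) -l't [wprod [::]]/wprod big_nil.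
  by rewrite [LHS]mulg1.
exfalso; apply: v0; apply: vE.
by move: uE; rewrite t1 mul1g => <-; rewrite wl; exact: valP.
Qed.

End words.

(** * Countability, and transfer of stationary measures to and from the subgroup *)

Lemma countable_seq (T : choiceType) : countable [set: T] -> countable [set: seq T].
Proof.
move=> /countable_injP[f finj]; apply/countable_injP.
have inj x y : f x = f y -> x = y by move=> fxy; apply: finj; rewrite ?inE.
exists (fun s : seq T => pickle (map f s)) => s s' _ _ /= /(pcan_inj (@pickleK _)).
exact: (inj_map inj).
Qed.

Lemma finitely_generated_countable (G : groupType) :
  finitely_generated G -> countable [set: G].
Proof.
move=> [s hs].
pose letter (x : bool * 'I_(size s)) : G :=
  if x.1 then (nth 1 s x.2)%g else (nth 1 s x.2)^-1%g.
pose ev (w : seq (bool * 'I_(size s))) : G := wprod (map letter w).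
pose inv (w : seq (bool * 'I_(size s))) := rev (map (fun x => (~~ x.1, x.2)) w).
have ev_cat v w : ev (v ++ w) = (ev v * ev w)%g by rewrite /ev map_cat wprod_cat.
have ev_inv w : ev (inv w) = (ev w)^-1%g.
  elim: w => [|x w ih]; first by rewrite /ev /wprod !big_nil invg1.
  rewrite /inv /= rev_cons -cats1 ev_cat ih [ev (x :: w)](ev_cat [:: x]) invgM.
  congr (_ * _)%g; rewrite /ev /wprod !big_seq1 /letter/=.
  by case: x.1; rewrite ?invgK.
have evT g : exists w, ev w = g.
  apply/asboolP; apply: (hs [pred g | `[< exists w, ev w = g >]]).
    split; first by apply/asboolP; exists [::]; rewrite /ev /wprod big_nil.
    move=> _ _ /asboolP[v <-] /asboolP[w <-]; apply/asboolP.
    by exists (v ++ inv w); rewrite ev_cat ev_inv.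
  move=> x xs; apply/asboolP.
  have xi : (index x s < size s)%N by rewrite index_mem.
  exists [:: (true, Ordinal xi)].
  by rewrite /ev /wprod big_seq1 /letter/= nth_index.
have -> : [set: G] = ev @` [set: seq (bool * 'I_(size s))].
  by apply/seteqP; split=> // g _; have [w <-] := evT g; exists w.
exact: (card_le_trans (card_image_le _ _) (countableP _)).
Qed.

Section return_stationary.
Context {R : realType} {G : groupType} (mu : G -> R) (hmu : is_prob mu).
Variables (S : {pred G}) (n : nat) (c : G -> 'I_n).
Hypothesis gS : group_closed S.
Hypothesis cE : forall g h, c g = c h <-> (g^-1 * h)%g \in S.
Hypothesis nS : normal_in S.
Hypothesis cG : countable [set: G].
Variable L : subGroupType S.
Context {X : ptopologicalType} (act : G -> X -> X).
Hypothesis hG : is_Gspace act.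
Local Open Scope ereal_scope.

Let actL (l : L) := act (val l).

Let mact g (A : set (borel X)) : measurable A -> measurable ((act g : borel X -> borel X) @^-1` A).
Proof. by move=> mA; rewrite -[_ @^-1` _]setTI; exact: (act_borel hG). Qed.

(** For a Borel set [A], the mass of [A] under [g nu] is a bounded harmonic function of [g]; its
    harmonicity for the return law, read at 1, is the claim. *)
Lemma stationary_restrict (nu : probability (borel X) R) :
  stationary act mu nu -> stationary actL (@return_law R G mu S L) nu.
Proof.
move=> hst A mA.
pose f g := fine (nu (act g @^-1` A)).
have fE g : (f g)%:E = nu (act g @^-1` A).
  by rewrite /f fineK//; apply: fin_num_measure; exact: mact.
have fB g : (0 <= f g <= 1)%R.
  by rewrite -!lee_fin fE measure_ge0/= probability_le1//; exact: mact.
have hf : avg mu (EFin \o f) = EFin \o f.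
  apply/funext => g; rewrite /avg /= fE -(hst _ (mact g mA)).
  apply: eq_esum => s _; rewrite fE /translate /pushforward; congr (_ * nu _).
  apply/seteqP; split=> x /=; have [_ _ -> _] := hG => //.
have := congr1 (@^~ 1%g) (return_law_harmonic hmu gS cE nS L fB hf).
rewrite /= val1 fE (_ : act 1%g @^-1` A = A); last first.
  by apply/seteqP; split=> x /=; have [_ -> _ _] := hG.
move=> <-; apply: eq_esum => l _; rewrite mul1g fE.
by [].
Qed.

(* The stationary measure is the expected occupation measure, along a left
   random walk, of an excursion away from S. *)
Lemma stationary_extend (nu0 : probability (borel X) R) :
  stationary actL (@return_law R G mu S L) nu0 ->
  exists nu : probability (borel X) R, stationary act mu nu.
Proof.
move=> hst.
pose E := left_excursion S.
pose b w : R := if w \in E then weight mu w else 0%R.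
have b0 w : (0 <= b w)%R by rewrite /b; case: ifP => // _; exact: weight_ge0.
have wt0 w : 0 <= (weight mu w)%:E by rewrite lee_fin; exact: weight_ge0.
pose A_ g : {mfun borel X >-> borel X} :=
  HB.pack (act g : borel X -> borel X) (isMeasurableFun.Build _ _ _ _ _ (@act_borel _ _ _ hG g)).
have [m [mE _]] := mixture [::] (fun w => distribution nu0 (A_ (wprod w))) (countable_seq cG) b0.
have mEE A : m A = \esum_(w in E) ((weight mu w)%:E * nu0 (act (wprod w) @^-1` A)).
  rewrite mE [RHS]esum_mkcond; apply: eq_esum => w _; rewrite /b.
  by case: ifP => // _; rewrite mul0e.
have mT : m setT = \esum_(w in E) (weight mu w)%:E.
  by rewrite mEE; apply: eq_esum => w _; rewrite preimage_setT probability_setT mule1.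
have m_fin : m setT \is a fin_num.
  rewrite mT ge0_fin_numE ?esum_ge0//.
  by apply: le_lt_trans (left_excursion_mass hmu gS cE) _; rewrite ltry.
have m_pos : (0 < fine (m setT))%R.
  rewrite -lte_fin fineK// mT; apply: (@lt_le_trans _ _ (weight mu [::])%:E).
    by rewrite lte_fin /weight big_nil.
  apply: esum_ge; exists [set [::]]; last by rewrite fsbig_set1.
  by split=> // _ ->.
(* The total mass of [m] is the expected return time: finite by [left_excursion_mass], positive
   because of the empty word. *)
have Zi0 : (0 <= (fine (m setT))^-1)%R by rewrite invr_ge0 ltW.
pose nu' : {measure set (borel X) -> \bar R} := mscale (NngNum Zi0) m.
have nu'1 : nu' setT = 1.
  suff : (fine (m setT))^-1%:E * m setT = 1 by [].
  by rewrite -[X in _ * X](fineK m_fin) -EFinM mulVf// gt_eqF.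
exists (mk_probability nu'1) => A mA.
have -> : mk_probability nu'1 A = (fine (m setT))^-1%:E * m A by [].
pose f g := fine (nu0 (act g @^-1` A)).
have f0 g : (0 <= f g)%R by apply: fine_ge0.
have fE g : (f g)%:E = nu0 (act g @^-1` A).
  by rewrite /f fineK//; apply: fin_num_measure; exact: mact.
pose F w := (weight mu w)%:E * (f (wprod w))%:E.
have F0 w : 0 <= F w by rewrite mule_ge0// lee_fin.
have f1 : (f 1%g)%:E = nu0 A.
  rewrite fE; congr (nu0 _).
  by apply/seteqP; split=> x /=; have [_ -> _ _] := hG.
(* The balance equation of left excursions has a start term and a return term; stationarity of [nu0]
   makes them equal, and cancelling them shows that [m] is invariant under convolution by [mu]. *)
have retF : \esum_(v in first_return S) F v = (f 1%g)%:E.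
  rewrite -(return_law_esum hmu gS cE L f0) f1 -(hst _ mA).
  by apply: eq_esum => l _; rewrite fE.
have := left_excursion_esum S F0; rewrite retF.
have -> : F [::] = (f 1%g)%:E.
  by rewrite /F /weight /wprod !big_nil mul1e.
rewrite [RHS]addeC => eF0.
have eF := adde_cancel (isT : (f 1%g)%:E \is a fin_num) eF0.
transitivity (\esum_(s in [set: G]) ((fine (m setT))^-1%:E * ((mu s)%:E * m (act s @^-1` A)))).
  by apply: eq_esum => s _; rewrite muleCA.
rewrite esumZl//; last by move=> s; rewrite mule_ge0// lee_fin; apply hmu.1.
congr (_ * _); rewrite mEE.
transitivity (\esum_(v in E) F v); last by apply: eq_esum => v _; rewrite /F fE.
rewrite -eF exchange_esum//; apply: eq_esum => s _.
rewrite mEE -esumZl; last 2 first.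
- exact: hmu.1.
- by move=> w; rewrite mule_ge0.
apply: eq_esum => w _; rewrite /F weight_cons wprod_cons fE mulrC EFinM muleA.
congr (_ * nu0 _).
by apply/seteqP; split=> x /=; have [_ _ -> _] := hG.
Qed.
End return_stationary.

(** * Fixed points of a group with trivial amenable radical *)

Section dietzmann.
Local Open Scope group_scope.
Context {G : groupType} (C : seq G) (m : nat).
Hypothesis m_gt0 : (0 < m)%N.
Hypothesis CJ : forall x g, x \in C -> x ^ g \in C.
Hypothesis C_torsion : forall x, x \in C -> x ^+ m = 1.

Let over (w : seq G) := all (mem C) w.

Let wprod_conj (g : G) w : wprod (map (conjg^~ g) w) = (wprod w) ^ g.
Proof.
elim: w => [|x w ih]; first by rewrite /wprod !big_nil conj1g.
by rewrite /= !wprod_cons ih conjMg.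
Qed.

Let over_conj (g : G) w : over w -> over (map (conjg^~ g) w).
Proof.
by move=> /allP h; apply/allP => _ /mapP[x /h xC ->]; exact: CJ.
Qed.

(** Moving a letter [c] to the front conjugates the letters it passes by [c]. Other occurrences of
    [c] are unaffected, so their number drops by exactly one and the move can be repeated. *)
Let pull c w : over w -> c \in w -> exists w', [/\ over w',
  wprod w = c * wprod w', size w = (size w').+1 &
  count_mem c w = (count_mem c w').+1].
Proof.
have cc : c ^ c = c by rewrite conjgE mulKg.
move=> ow cw; move: ow; case: (splitPr cw) => w1 w2;
rewrite /over all_cat /= => /and3P; case=> o1 _ o2.
exists (map (conjg^~ c) w1 ++ w2); split.
- by rewrite /over all_cat o2 andbT; exact: over_conj.
- rewrite !wprod_cat wprod_cons wprod_conj conjgE !mulgA.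
  by rewrite mulgV mul1g.
- by rewrite !size_cat size_map addnS.
- rewrite !count_cat /= eqxx add1n addnS count_map; congr (_ + _).+1.
  apply: eq_count => x /=; apply/eqP/eqP => [->//|xc].
  by apply: (conjg_inj c); rewrite xc cc.
Qed.

Let pulln c k w : over w -> (k <= count_mem c w)%N -> exists w', [/\ over w',
  wprod w = c ^+ k * wprod w' & size w = (k + size w')%N].
Proof.
elim: k w => [|k ih] w ow kw; first by exists w; rewrite expg0 mul1g.
have cw : c \in w by rewrite -has_pred1 has_count; apply: leq_trans kw.
have [w1 [ow1 -> -> cnt]] := pull ow cw.
have [|w2 [ow2 -> ->]] := ih w1 ow1; first by rewrite -ltnS -cnt.
by exists w2; rewrite expgS mulgA addSn.
Qed.

(** By pigeonhole some letter occurs at least [m] times; pulled to the front, [m] of its copies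
    multiply to 1. *)
Let shorten w : over w -> (size C * m < size w)%N -> exists w',
  [/\ over w', wprod w = wprod w' & (size w' < size w)%N].
Proof.
move=> ow lw.
have [c cC cm] : exists2 c, c \in C & (m <= count_mem c w)%N.
  apply: contrapT => h; move: lw; apply/negP; rewrite -leqNgt.
  have hC c : c \in C -> (count_mem c w <= m)%N.
    by move=> cC; rewrite leqNgt; apply/negP => /ltnW cm; apply: h; exists c.
  have : (size w <= \sum_(c <- C) count_mem c w)%N.
    rewrite -(count_predT w).
    elim: w ow {h hC} => [//|x w ih] /= /andP[xC ow].
    rewrite big_split/= leq_add ?ih//.
    by rewrite (big_rem x)//= eqxx.
  move=> /leq_trans; apply.
  elim: (C) (hC) => [|c D ih] hD; first by rewrite big_nil.
  rewrite big_cons mulSn leq_add ?hD ?inE ?eqxx//.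
  by apply: ih => x xD; apply: hD; rewrite inE xD orbT.
have [w' [ow' -> ->]] := pulln ow cm.
exists w'; split=> //; first by rewrite C_torsion// mul1g.
by rewrite -[X in (X < _)%N]add0n ltn_add2r.
Qed.

(** Listing 1 at every stage includes the words shorter than [k]. *)
Fixpoint products k : seq G :=
  if k is k'.+1 then 1 :: [seq c * x | c <- C, x <- products k'] else [:: 1].

Let productsP k w : over w -> (size w <= k)%N -> wprod w \in products k.
Proof.
elim: k w => [|k ih] [|x w]//=; rewrite ?/wprod ?big_nil ?inE ?eqxx//.
move=> /andP[xC ow] wk; rewrite big_cons; apply/orP; right.
by apply/allpairsP; exists (x, wprod w); split => //; exact: ih.
Qed.

Let over_short w : over w -> exists w',
  [/\ over w', wprod w = wprod w' & (size w' <= size C * m)%N].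
Proof.
have [k] := ubnP (size w); elim: k w => // k ih w wk ow.
have [wC|wC] := leqP (size w) (size C * m); first by exists w.
have [w1 [ow1 -> w1w]] := shorten ow wC.
by apply: ih => //; apply: leq_trans w1w _.
Qed.

(* Equal letters can be moved together at the price of conjugating the letters
   in between, and m equal letters cancel: every product over C is a product of
   at most size C * m letters. *)
Lemma dietzmann : exists N : seq G, [/\ group_closed (mem N),
  normal_in (mem N) & {subset C <= N}].
Proof.
pose gen x := `[< exists w, over w /\ wprod w = x >].
exists [seq x <- products (size C * m) | gen x].
have NE x : (x \in [seq x <- products (size C * m) | gen x]) = gen x.
  rewrite mem_filter andb_idr// => /asboolP[w [/over_short[w' [ow' -> h]] <-]].
  exact: productsP.
have NE' x : (x \in mem [seq x <- products (size C * m) | gen x]) = gen x := NE x.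
have genM x y : gen x -> gen y -> gen (x * y).
  move=> /asboolP[v [ov <-]] /asboolP[w [ow <-]]; apply/asboolP.
  by exists (v ++ w); split; [rewrite /over all_cat; apply/andP|rewrite wprod_cat].
have gen1 : gen 1 by apply/asboolP; exists [::]; rewrite /wprod big_nil.
have genV x : gen x -> gen x^-1.
  move=> /asboolP[w [ow <-]]; elim: w ow => [_|c w ih /= /andP[cC /ih gw]].
    by rewrite /wprod big_nil invg1.
  rewrite wprod_cons invgM; apply: (genM) => //.
  (* Torsion turns inverses of letters into products of letters. *)
  have -> : c^-1 = c ^+ m.-1.
    by apply: (mulgI c); rewrite mulgV -expgS prednK// C_torsion.
  suff genX k : gen (c ^+ k) by exact: genX.
  elim: k => [|k ihk]; first by rewrite expg0.
  rewrite expgS; apply: (genM) => //; apply/asboolP; exists [:: c].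
  by split; rewrite ?/over /= ?cC// /wprod big_seq1.
split.
- split; first by rewrite NE'.
  move=> x y; rewrite !NE' => gx gy.
  by apply: (genM) => //; exact: genV.
- move=> x g; rewrite !NE' => /asboolP[w [ow <-]]; apply/asboolP.
  by exists (map (conjg^~ g) w); split; [exact: over_conj|rewrite wprod_conj].
- move=> c cC; rewrite NE; apply/asboolP; exists [:: c].
  by split; rewrite ?/over /= ?cC// /wprod big_seq1.
Qed.

End dietzmann.

Section subgroup_of_pred.
Context {G : groupType} (S : {pred G}) (gS : group_closed S).

(** The proof of closure is an argument, so that the type itself determines its group structure. *)
Definition subgroup_of_pred of group_closed S := {x : G | S x}.

Local Notation H := (subgroup_of_pred gS).

HB.instance Definition _ := [isSub of H for @sval G (fun x => S x)].
HB.instance Definition _ := [Choice of H by <:].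
HB.instance Definition _ := SubChoice_isSubGroup.Build G S H gS.

End subgroup_of_pred.

Lemma finite_amenable (R : realType) (H : groupType) (e : seq H) :
  uniq e -> (forall h, h \in e) -> amenable R H.
Proof.
move=> ue eH.
have e0 : (0 < size e)%N by have := eH 1%g; case: (e).
have se0 : (size e)%:R != 0 :> R by rewrite pnatr_eq0 -lt0n.
exists (fun A => (count (fun x => `[< A x >]) e)%:R / (size e)%:R); split.
- by move=> A; rewrite divr_ge0.
- rewrite (@eq_count _ _ predT) ?count_predT ?divff// => x /=; exact/asboolP.
- move=> A B AB; rewrite -mulrDl -natrD; congr (_%:R / _).
  rewrite -count_predUI [X in (_ + X)%N](@eq_count _ _ pred0); last first.
    move=> x /=; apply/negP => /andP[/asboolP Ax /asboolP Bx].
    by have : (A `&` B) x by []; rewrite AB.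
  rewrite count_pred0 addn0; apply: eq_count => x /=.
  by apply/asboolP/orP => -[/asboolP ?|/asboolP ?]; by [left|right|left; apply/asboolP|right; apply/asboolP].
- move=> g A; congr (_%:R / _).
  have pe : perm_eq (map (fun x => g^-1 * x)%g e) e.
    apply: uniq_perm => //; first by rewrite map_inj_uniq//; exact: mulgI.
    move=> x; rewrite eH; apply/mapP; exists (g * x)%g => //.
    by rewrite mulKg.
  rewrite -(permP pe (fun x => `[< A x >])) count_map.
  apply: eq_count => x /=; apply/asboolP/asboolP => [[a Aa <-]|Ax].
    by rewrite mulKg.
  by exists (g^-1 * x)%g => //; rewrite mulgA mulgV mul1g.
Qed.

Lemma finite_normal_trivial (R : realType) (G : groupType) (N : seq G) :
  trivial_amenable_radical R G -> group_closed (mem N) -> normal_in (mem N) ->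
  forall x, x \in N -> x = 1%g.
Proof.
move=> [S [M [[_ _ hmax] S1]]] gN nN x xN.
have H : subGroupType (mem N) := subgroup_of_pred gN.
pose e : seq H := pmap insub (undup N).
have am : amenable R H.
  apply: (@finite_amenable R H e).
    exact: (pmap_sub_uniq _ (undup_uniq N)).
  move=> h; rewrite mem_pmap_sub mem_undup; exact: (valP h).
have := hmax _ H nN am x xN => xS.
by have : [set` S] x by []; rewrite S1.
Qed.

Lemma exists_max_seq {R : realType} (T : eqType) (f : T -> R) (l : seq T) x0 :
  x0 \in l -> exists2 x, x \in l & forall y, y \in l -> f y <= f x.
Proof.
move=> x0l; case: l x0l => [//|a l _]; elim: l a => [|b l ih] a.
  by exists a; rewrite ?inE// => y; rewrite inE => /eqP ->.
have [x xl hx] := ih b.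
have [ax|xa] := leP (f a) (f x).
  exists x; first by rewrite inE xl orbT.
  by move=> y; rewrite inE => /predU1P[->//|/hx].
exists a; first by rewrite inE eqxx.
move=> y; rewrite inE => /predU1P[->//|/hx yx].
exact: le_trans yx (ltW xa).
Qed.

Section fixed_points.
Context {R : realType} {G : groupType} {X : ptopologicalType}.
Variables (act : G -> X -> X) (d : X -> X -> R).
Hypotheses (hG : is_Gspace act) (hd : is_metric_for d).
Variables (mu : G -> R) (nu : probability (borel X) R).
Hypotheses (hmu : is_prob mu) (gmu : generating mu).
Hypothesis hst : stationary act mu nu.
Variables (S : {pred G}) (n : nat) (c : G -> 'I_n).
Hypothesis gS : group_closed S.
Hypothesis cE : forall g h, c g = c h <-> (g^-1 * h)%g \in S.

Definition fixpoints (g : G) : set (borel X) := [set x | act g x = x].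

Hypothesis freeS : forall g, g \in S -> g <> 1%g -> nu (fixpoints g) = 0%E.

Let act1 x : act 1%g x = x. Proof. by case: hG. Qed.
Let actM g h x : act (g * h)%g x = act g (act h x). Proof. by case: hG. Qed.

Lemma measurable_fixpoints g : measurable (fixpoints g).
Proof.
have [d0 dC dT _] := hd.
have cf : continuous (fun x => d (act g x) x).
  move=> x; apply/(@cvgrPdist_lt _ R^o) => e e0.
  have e2 : 0 < e / 2 by rewrite divr_gt0.
  have h1 := near_dist hd x e2.
  have [_ _ _ actc] := hG.
  have h2 : \forall z \near x, d (act g x) (act g z) < e / 2.
    exact: (actc g x _ (near_dist hd (act g x) e2)).
  apply: filterS2 h1 h2 => z xz gz.
  rewrite [ltRHS]splitr ltr_norml; apply/andP; split.
    have := dT (act g z) (act g x) z; have := dT (act g x) x z.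
    by rewrite (dC (act g z) (act g x)); move: xz gz => /=; lra.
  have := dT (act g x) (act g z) x; have := dT (act g z) z x.
  by rewrite (dC z x); move: xz gz => /=; lra.
rewrite (_ : fixpoints g = (fun x => d (act g x) x : R) @^-1` [set 0]).
  apply: closed_borel; apply: preimage_closed; last exact: closed_eq.
  by move=> x _; exact: cf.
by apply/seteqP; split=> x /=; move/d0.
Qed.

Let phi g : R := fine (nu (fixpoints g)).

Let phiE g : (phi g)%:E = nu (fixpoints g).
Proof. by rewrite /phi fineK//; apply: fin_num_measure; exact: measurable_fixpoints. Qed.

Let phi0 g : 0 <= phi g. Proof. by apply: fine_ge0. Qed.

(** The preimage under [act s] of the fixed points of [h] is the fixed point set of [h ^ s]; so this
    is stationarity evaluated on a fixed point set, and says that [phi] is harmonic along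
    conjugation. *)
Lemma fixpoints_harmonic h :
  (\esum_(s in [set: G]) ((mu s)%:E * (phi (h ^ s)%g)%:E) = (phi h)%:E)%E.
Proof.
rewrite phiE -(hst (measurable_fixpoints h)).
apply: eq_esum => s _; congr (_ * _)%E; rewrite phiE; congr (nu _).
have actK y : act s (act s^-1%g y) = y by rewrite -actM mulgV act1.
have actVK y : act s^-1%g (act s y) = y by rewrite -actM mulVg act1.
apply/seteqP; split=> x; rewrite /fixpoints /= conjgE !actM => hx.
  by have := congr1 (act s) hx; rewrite actK.
by rewrite hx actVK.
Qed.

(** A common fixed point of [h] and [h'] is fixed by [h^-1 * h'], a nontrivial element of [S]. *)
Let nullI h h' : c h = c h' -> h <> h' -> nu (fixpoints h `&` fixpoints h') = 0%E.
Proof.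
move=> /cE hS hh'.
have h1 : (h^-1 * h')%g <> 1%g.
  by move=> e; apply: hh'; rewrite -[LHS]mulg1 -e mulgA mulgV mul1g.
apply/eqP; rewrite -measure_le0 -(freeS hS h1); apply: le_measure; rewrite ?inE.
- by apply: measurableI; exact: measurable_fixpoints.
- exact: measurable_fixpoints.
- move=> x [/= hx h'x]; rewrite /fixpoints/= actM h'x.
  by rewrite -{1}hx -actM mulVg act1.
Qed.

Let fixU (l : seq G) : set (borel X) := [set x | exists2 h, h \in l & fixpoints h x].

Let fixU_nil : fixU [::] = set0.
Proof. by apply/seteqP; split=> x // -[]. Qed.

Let fixU_cons h l : fixU (h :: l) = fixpoints h `|` fixU l.
Proof.
apply/seteqP; split=> x.
  by move=> [h']; rewrite inE => /predU1P[->|h'l] h'x; [left|right; exists h'].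
move=> [hx|[h' h'l h'x]]; first by exists h; rewrite ?inE ?eqxx.
by exists h'; rewrite ?inE ?h'l ?orbT.
Qed.

Let measurable_fixU l : measurable (fixU l).
Proof.
elim: l => [|h l ih]; first by rewrite fixU_nil.
by rewrite fixU_cons; apply: measurableU => //; exact: measurable_fixpoints.
Qed.

(** Within one coset the fixed point sets are disjoint up to null sets, so their masses add up
    inside a probability. *)
Lemma coset_fixpoints (l : seq G) i : uniq l -> (forall h, h \in l -> c h = i) ->
  \sum_(h <- l) phi h <= 1.
Proof.
move=> ul hl.
suff : (nu (fixU l) = (\sum_(h <- l) phi h)%:E)%E.
  by move=> e; rewrite -lee_fin -e; exact: probability_le1.
elim: l ul hl => [|h l ih] ul hl; first by rewrite fixU_nil measure0 big_nil.
move: ul => /= /andP[hnl ul].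
have cl h' : h' \in l -> c h' = i by move=> h'l; apply: hl; rewrite inE h'l orbT.
have ch : c h = i by apply: hl; rewrite inE eqxx.
have mh := measurable_fixpoints h.
have null : nu (fixpoints h `&` fixU l) = 0%E.
  have : forall h', h' \in l -> h' <> h /\ c h' = i.
    by move=> h' h'l; split; [move=> e; move: hnl; rewrite -e h'l|exact: cl].
  elim: (l) => [|h' l' ih'] hl'; first by rewrite fixU_nil setI0 measure0.
  rewrite fixU_cons setIUr; apply/eqP; rewrite -measure_le0.
  have [h'h ch'] := hl' h' (mem_head _ _).
  apply: le_trans (measureU2 _ _ _) _.
  - by apply: measurableI => //; exact: measurable_fixpoints.
  - exact: measurableI.
  have e1 : nu (fixpoints h `&` fixpoints h') = 0%E.
    by apply: nullI; [rewrite ch ch'|move=> e; apply: h'h].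
  have e2 : nu (fixpoints h `&` fixU l') = 0%E.
    by apply: ih' => h'' h''l; apply: hl'; rewrite inE h''l orbT.
  by rewrite [X in (X + _)%E]e1 [X in (_ + X)%E]e2 adde0.
rewrite fixU_cons big_cons EFinD -ih// phiE.
have mhl : measurable (fixU l `\` fixpoints h) by exact: measurableD.
have -> : (nu (fixU l) = nu (fixU l `\` fixpoints h))%E.
  by rewrite [LHS](measureDI nu (measurable_fixU l) mh) setIC [X in (_ + X)%E]null adde0.
rewrite (_ : fixpoints h `|` fixU l = fixpoints h `|` (fixU l `\` fixpoints h)).
  by rewrite measureU//; apply/seteqP; split=> x // [hx [_ nhx]].
apply/seteqP; split=> x; last by move=> [|[]]; [left|right].
by have [hx|nhx] := pselect (fixpoints h x); [left|move=> []//; right].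
Qed.

Hypothesis hrad : trivial_amenable_radical R G.

(** The gaps [M - phi (h ^ s)] are nonnegative and average to 0, hence vanish wherever [mu] is
    positive. *)
Let orbit_eq_max M h : (forall s, phi (h ^ s)%g <= M) -> phi h = M ->
  forall t, 0 < mu t -> phi (h ^ t)%g = M.
Proof.
move=> hM hE t mut; apply/eqP; rewrite eq_le hM/= leNgt; apply/negP => lt.
have M0 : 0 <= M by rewrite -hE.
have mu0 s : (0 <= (mu s)%:E)%E by rewrite lee_fin; apply hmu.1.
have gap0 s : (0 <= (M - phi (h ^ s)%g)%:E)%E by rewrite lee_fin subr_ge0.
have p0 s : (0 <= (phi (h ^ s)%g)%:E)%E by rewrite lee_fin.
have : (\esum_(s in [set: G]) ((mu s)%:E * M%:E) = M%:E)%E.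
  by rewrite esumZr// hmu.2 mul1e.
have -> : (\esum_(s in [set: G]) ((mu s)%:E * M%:E) =
    M%:E + \esum_(s in [set: G]) ((mu s)%:E * (M - phi (h ^ s)%g)%:E))%E.
  rewrite -{2}hE -fixpoints_harmonic -esumD; try by move=> *; exact: mule_ge0.
  by apply: eq_esum => s _; rewrite -ge0_muleDr// -EFinD addrC subrK.
rewrite -[X in _ = X -> _]adde0 => /(adde_cancel (isT : M%:E \is a fin_num)) e0.
have : ((mu t)%:E * (M - phi (h ^ t)%g)%:E <= 0)%E.
  rewrite -e0; apply: esum_ge; exists [set t]; first by split.
  by rewrite fsbig_set1.
by rewrite -EFinM lee_fin leNgt mulr_gt0// subr_gt0.
Qed.

(* [phi] restricted to the conjugacy class of g is harmonic and has finite sum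
   over each coset of S, so it attains its maximum; by the maximum principle it
   is constant and the class is finite. *)
Lemma null_fixpoints g : g <> 1%g -> nu (fixpoints g) = 0%E.
Proof.
move=> g1; apply: contrapT => nug.
have pg : 0 < phi g.
  rewrite lt_neqAle phi0 andbT eq_sym; apply/eqP => e; apply: nug.
  by rewrite -phiE e.
pose C : set G := [set h | exists s, h = (g ^ s)%g].
have Cg : C g by exists 1%g; rewrite conjg1.
have CJ h s : C h -> C (h ^ s)%g.
  by move=> [t ->]; exists (t * s)%g; rewrite conjgM.
have finF : finite_set [set h | C h /\ phi g <= phi h].
  rewrite (_ : [set h | _] =
      \bigcup_(i in [set: 'I_n]) [set h | [/\ C h, phi g <= phi h & c h = i]]); last first.
    apply/seteqP; split=> h; last by move=> [i _ []].
    by move=> [Ch gh]; exists (c h).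
  apply: bigcup_finite => [|i _]; first exact: finite_finset.
  apply: contrapT => infi.
  (* More than [1 / phi g] elements of one coset, each with value at least [phi g], would exceed the
     bound 1 of [coset_fixpoints]. *)
  have [N hN] : exists N, 1 < phi g * N%:R.
    exists (Num.bound (phi g)^-1).
    rewrite -ltr_pdivrMl// mulr1.
    by have := archi_boundP (_ : 0 <= (phi g)^-1); apply; rewrite invr_ge0 ltW.
  have [B BF BN] := infinite_set_fset N infi.
  have := @coset_fixpoints (finmap.enum_fset B) i (finmap.fset_uniq B).
  have hB h : h \in finmap.enum_fset B -> [/\ C h, phi g <= phi h & c h = i].
    by move=> hB; exact: BF.
  move=> /(_ (fun h hh => let: And3 _ _ x := hB h hh in x)).
  rewrite leNgt => /negP; apply; apply: lt_le_trans hN _.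
  apply: (@le_trans _ _ (\sum_(h <- finmap.enum_fset B) phi g)).
    rewrite big_const_seq count_predT iter_addr addr0 -[leRHS]mulr_natr.
    by rewrite ler_pM2l// ler_nat.
  by rewrite !big_seq; apply: ler_sum => h /hB[].
have [l lE] := (finite_seqP _).1 finF.
have memF h : h \in l <-> C h /\ phi g <= phi h.
  have : [set` l] h <-> [set h | C h /\ phi g <= phi h] h by rewrite lE.
  by [].
have gl : g \in l by apply/memF.
have [h hl hmax] := exists_max_seq phi gl.
have [Ch gh] := (memF h).1 hl.
have hmaxC t : C t -> phi t <= phi h.
  move=> Ct; have [gt|tg] := leP (phi g) (phi t); first by apply: hmax; apply/memF.
  exact: le_trans (ltW tg) gh.
(* The elements whose conjugation preserves the maximum form a semigroup containing the support of
   [mu], hence are all of [G]. *)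
have const s t : C t -> phi t = phi h -> phi (t ^ s)%g = phi h.
  pose T : {pred G} := [pred s | `[< forall t, C t -> phi t = phi h -> phi (t ^ s)%g = phi h >]].
  have : s \in T.
    apply: gmu => [s1 s2 /asboolP h1 /asboolP h2|s1 mus1].
      apply/asboolP => t' Ct' t'h; rewrite conjgM; apply: h2; first exact: CJ.
      exact: h1.
    apply/asboolP => t' Ct' t'h.
    by apply: (orbit_eq_max _ t'h mus1) => s'; apply: hmaxC; exact: CJ.
  by move=> /asboolP; apply.
have Cl t : t \in l <-> C t.
  split; first by move=> /memF[].
  move=> [s tE]; apply/memF; split; first by exists s.
  have [s' hE] := Ch.
  have -> : t = (h ^ (s'^-1 * s))%g by rewrite hE -conjgM mulgA mulgV mul1g.
  by rewrite const.
(* Two of the [n.+1] first powers of [g] share a coset, so a positive power lies in [S]. It fixes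
   every fixed point of [g], a set of positive measure, and is trivial by freeness of [S]; so [g] is
   torsion. *)
have [k k0 gk] : exists2 k, (0 < k)%N & (g ^+ k)%g \in S.
  have [i [j [ij cij]]] : exists i j : 'I_n.+1, (i < j)%N /\ c (g ^+ i)%g = c (g ^+ j)%g.
    apply: contrapT => hinj.
    have inj : injective (fun i : 'I_n.+1 => c (g ^+ i)%g).
      move=> i j cij; apply: val_inj => /=; case: (ltngtP i j) => // ij; exfalso; apply: hinj.
        by exists i, j.
      by exists j, i.
    by have := leq_card _ inj; rewrite !card_ord ltnn.
  exists (j - i)%N; first by rewrite subn_gt0.
  have /cE := cij; congr (_ \in S).
  by rewrite -{1}(subnKC (ltnW ij)) expgnDr mulgA mulVg mul1g.
have gk1 : (g ^+ k)%g = 1%g.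
  apply: contrapT => gk1; apply: nug; apply/eqP; rewrite -measure_le0.
  rewrite -(freeS gk gk1); apply: le_measure; rewrite ?inE.
  - exact: measurable_fixpoints.
  - exact: measurable_fixpoints.
  move=> x gx; rewrite /fixpoints/=; elim: (k) => [|j ih]; first by rewrite expg0.
  by rewrite expgS actM ih.
have lJ x s : x \in l -> (x ^ s)%g \in l by move=> /Cl /CJ h'; apply/Cl.
have l_torsion x : x \in l -> (x ^+ k)%g = 1%g.
  by move=> /Cl[s ->]; rewrite -conjXg gk1 conj1g.
have [N [gN nN lN]] := dietzmann k0 lJ l_torsion.
by apply: g1; apply: (finite_normal_trivial hrad gN nN); exact: lN.
Qed.
End fixed_points.

(** * The induced action *)

Lemma val1L (G : groupType) (S : {pred G}) (L : subGroupType S) :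
  val (1%g : L) = 1%g.
Proof. exact: val1. Qed.

Section induced_action.
Context {G : groupType} {S : {pred G}} {L : subGroupType S}.
Variables (n : nat) (r : 'I_n -> G) (c : G -> 'I_n).
Hypothesis cE : forall g h, c g = c h <-> (g^-1 * h)%g \in S.
Hypothesis cr : forall i, c (r i) = i.
Hypothesis nS : normal_in S.
Context {X : ptopologicalType} (actX : L -> X -> X).
Hypothesis hX : is_Gspace actX.

Local Notation Y := (power n X).

(** The value 1 outside [S] is only a default: the cocycle and the conjugates to which this is
    applied lie in [S]. *)
Definition to_sub (g : G) : L := insubd 1%g g.

Lemma to_subK g : g \in S -> val (to_sub g) = g.
Proof. by move=> gS; rewrite /to_sub insubdK. Qed.

Lemma val_sub (l : L) : val l \in S. Proof. exact: valP. Qed.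

(* The induced action on the L-equivariant maps G -> X, which are identified
   with their values on the coset representatives r i. *)
Definition induced_act (g : G) (y : Y) : Y := fun i =>
  let k := c (g^-1 * r i)%g in actX (to_sub ((r i)^-1 * (g * r k))%g) (y k).

Let cocycle_in g i : ((r i)^-1 * (g * r (c (g^-1 * r i))))%g \in S.
Proof.
set k := c _; have : c (g^-1 * r i)%g = c (r k) by rewrite cr.
by move=> /cE; rewrite invgM invgK mulgA.
Qed.

Lemma induced_Gspace : is_Gspace induced_act.
Proof.
have [cX act1 actM actc] := hX.
have SS := val_sub.
have S1 : 1%g \in S by rewrite -(val1L L) SS.
split.
- exact: power_compact.
- move=> y; apply/funext => i; rewrite /induced_act /= invg1 !mul1g cr mulVg.
  rewrite (_ : to_sub 1%g = 1%g) ?act1//.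
  by apply: val_inj; rewrite to_subK// val1.
- move=> g h y; apply/funext => i; rewrite /induced_act.
  set k := c (g^-1 * r i)%g.
  have ck : c ((g * h)^-1 * r i)%g = c (h^-1 * r k)%g.
    apply/cE; rewrite invgM invgK.
    have /cE : c (g^-1 * r i)%g = c (r k) by rewrite cr.
    by rewrite invgM invgK !mulgA mulgK.
  rewrite ck -actM; congr actX; apply: val_inj.
  rewrite valM !to_subK.
  + by rewrite !mulgA mulgK.
  + exact: cocycle_in.
  + exact: cocycle_in.
  + by rewrite -ck; exact: cocycle_in.
- move=> g; apply: continuous_to_power => i y.
  apply: (@continuous_comp _ _ _ (fun y : Y => y (c (g^-1 * r i)%g)) (actX (to_sub _))).
    exact: power_proj_continuous.
  exact: actc.
Qed.

Definition conj_sub i (l : L) : L := to_sub (val l ^ r i)%g.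
Definition conj_subV i (l : L) : L := to_sub (val l ^ (r i)^-1)%g.

Let val_conj i l : val (conj_sub i l) = (val l ^ r i)%g.
Proof. by rewrite to_subK//; apply: nS; exact: val_sub. Qed.

Let val_conjV i l : val (conj_subV i l) = (val l ^ (r i)^-1)%g.
Proof. by rewrite to_subK//; apply: nS; exact: val_sub. Qed.

Lemma conj_subK i : cancel (conj_sub i) (conj_subV i).
Proof. by move=> l; apply: val_inj; rewrite val_conjV val_conj conjgK. Qed.

Lemma conj_subVK i : cancel (conj_subV i) (conj_sub i).
Proof. by move=> l; apply: val_inj; rewrite val_conj val_conjV conjgKV. Qed.

Lemma conj_subM i l l' : conj_sub i (l * l')%g = (conj_sub i l * conj_sub i l')%g.
Proof. by apply: val_inj; rewrite valM !val_conj valM conjMg. Qed.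

(** By normality an element of the subgroup fixes every coset; it permutes no coordinates and acts
    on the i-th through its conjugate by [r i]. *)
Lemma induced_act_sub (l : L) : induced_act (val l) = twisted_act actX conj_sub l.
Proof.
apply/funext => y; apply/funext => i; rewrite /induced_act /twisted_act.
have -> : c ((val l)^-1 * r i)%g = i.
  rewrite -[RHS]cr; apply/cE; rewrite invgM invgK -mulgA -conjgE.
  by apply: nS; exact: val_sub.
by rewrite -conjgE.
Qed.

End induced_action.

(** * Mean-proximality and essential freeness of the induced action *)

Section mean_proximal_extension.
Context {R : realType} {G : groupType} {S : {pred G}} {L : subGroupType S}.
Variables (n : nat) (r : 'I_n -> G) (c : G -> 'I_n).
Hypothesis gS : group_closed S.
Hypothesis cE : forall g h, c g = c h <-> (g^-1 * h)%g \in S.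
Hypothesis cr : forall i, c (r i) = i.
Hypothesis nS : normal_in S.
Hypothesis cG : countable [set: G].
Context {X : ptopologicalType} (actX : L -> X -> X) (d : X -> X -> R).
Hypotheses (hX : is_Gspace actX) (hd : is_metric_for d).
Hypothesis hmp : forall mu : L -> R, is_prob mu -> generating mu ->
  exists nu : probability (borel X) R,
  [/\ stationary actX mu nu,
      forall nu' : probability (borel X) R, stationary actX mu nu' ->
        forall A : set (borel X), measurable A -> nu' A = nu A
    & is_boundary actX mu nu].

Local Notation Y := (power n X).
Local Notation act := (induced_act r c actX).
Local Notation t := (conj_sub r (L := L)).
Local Notation tV := (conj_subV r (L := L)).
Local Notation dY := (power_dist d).

Let cL : countable [set: L].
Proof.
move: cG => /countable_injP[f finj]; apply/countable_injP.
exists (f \o val) => l l' _ _ /= /finj h; apply: val_inj; apply: h; by rewrite inE.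
Qed.

Let hG : is_Gspace act := induced_Gspace cE cr hX.
Let hdY : is_metric_for dY := power_dist_metric n hd.
Let tK := conj_subK r nS (L := L).
Let tVK := conj_subVK r nS (L := L).
Let tM := conj_subM r nS (L := L).
Let hY : is_Gspace (twisted_act actX t) := twisted_Gspace hX tM.

Lemma stationary_twisted (mu : G -> R) (nu : probability (borel Y) R) : is_prob mu ->
  stationary act mu nu -> stationary (twisted_act actX t) (@return_law R G mu S L) nu.
Proof.
move=> hmu hst.
have := stationary_restrict hmu gS cE nS L hG hst.
by congr stationary; apply/funext => l; rewrite induced_act_sub.
Qed.

Lemma induced_mean_proximal : mean_proximal R act.
Proof.
split=> //; first by exists dY.
move=> mu hmu gmu.
have hmuL := return_law_prob hmu gS cE L.
have gmuL := return_law_generating hmu gS cE (L := L) gmu.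
have [phi [nuL [stL phiE contr]]] :=
  twisted_contraction hX hd cL tK tVK tM hmp hmuL gmuL.
have [nu hst] : exists nu : probability (borel Y) R, stationary act mu nu.
  apply: (stationary_extend hmu gS cE cG (L := L) hG (nu0 := nuL)).
  by move: stL; congr stationary; apply/funext => l; rewrite induced_act_sub.
have hstL := stationary_twisted hmu hst.
(* On the subgroup the costs are the same for all [mu]-stationary measures: each of them is
   stationary for the return law, whose costs are given by [phi]. *)
have costL nu' l p : stationary act mu nu' -> cost act dY nu' (val l) p = phi l p.
  move=> st'; rewrite -(phiE _ (stationary_twisted hmu st')).
  by rewrite /cost induced_act_sub.
have [a ha] := exists_argmin hG hdY (cost_triangle hG hdY nu).
have haL l q : phi l (a (val l)) <= phi l q by rewrite -!(costL nu).
exists nu; split => //.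
(* Uniqueness is proved on the subgroup, where contraction is known, both measures being stationary
   for the return law. *)
- move=> nu' st'; apply: (stationary_unique hY hdY hmuL cL (a := fun l => a (val l))).
  + exact: stationary_twisted.
  + by [].
  + move=> l p; rewrite !phiE//; exact: stationary_twisted.
  + have -> : (fun l => (cost (twisted_act actX t) dY nu' l (a (val l)))%:E) =
        (fun l => (phi l (a (val l)))%:E).
      by apply/funext => l; rewrite (phiE _ (stationary_twisted hmu st')).
    exact: contr.
- apply: (boundary_criterion hG hdY hmu cG hst (a := a)).
  pose V g := (cost act dY nu g (a g))%:E.
  have [B B0 hB] := cost_bound hG hdY.
  have VB g : (0 <= V g <= B%:E)%E by rewrite !lee_fin hB cost_ge0.
  have [V' [V'V V'h V'cvg]] := superharmonic_limit hmu cG VB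
    (cost_argmin_superharmonic hG hdY hmu cG hst ha).
  (* The identity lies in the subgroup, on which [V'] is harmonic for the return law and dominated
     by [V]; so [V' 1] is at most every average of [V] along that law. *)
  suff V'1 : V' 1%g = 0%E by rewrite -V'1; exact: V'cvg.
  have V'fin g : V' g \is a fin_num.
    have /andP[h1 h2] := V'V g; rewrite ge0_fin_numE//.
    by apply: le_lt_trans h2 _; rewrite ltry.
  pose f g := fine (V' g).
  have fE g : (f g)%:E = V' g by rewrite /f fineK.
  have fB g : 0 <= f g <= B.
    have /andP[h1 h2] := V'V g; have /andP[_ h3] := VB g.
    by rewrite -!lee_fin fE h1 (le_trans h2 h3).
  have hf : avg mu (EFin \o f) = EFin \o f.
    rewrite (_ : EFin \o f = V')//; by apply/funext => g; rewrite /= fE.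
  have hfL := return_law_harmonic hmu gS cE nS L fB hf.
  apply/eqP; rewrite eq_le; have /andP[-> _] := V'V 1%g; rewrite andbT.
  have := contr (fun l => a (val l)) haL; apply: cvge_ge; apply: nearW => k.
  rewrite -fE -(val1L L) -[leLHS](congr1 (@^~ (1%g : L)) (iter_avg_harmonic k hfL)).
  apply: le_iter_avg => // l; first by rewrite lee_fin; have /andP[] := fB (val l).
  rewrite fE; have /andP[_ h2] := V'V (val l); apply: le_trans h2 _.
  by rewrite /V costL.
Qed.

End mean_proximal_extension.

(** For freeness, [null_fixpoints] leaves only nontrivial elements of [S]. A point of the power
    fixed by such an element has a fixed coordinate, and the marginal there is stationary for a
    generating law on [L], so freeness of the original action applies. *)
Theorem theoremA4 (R : realType) (G : groupType) (S : {pred G})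
    (L : subGroupType S)
    (hfg : finitely_generated G)
    (hrad : trivial_amenable_radical R G)
    (hnormal : normal_in S)
    (hindex : finite_index S)
    (hL : has_ess_free_mean_proximal_action R L) :
  has_ess_free_mean_proximal_action R G.
Proof.
have gS : group_closed S.
  split; first by rewrite -(val1L L); exact: val_sub.
  move=> x y xS yS.
  have -> : (x / y)%g = val ((Sub x xS : L) / (Sub y yS : L))%g.
    by rewrite gmulfF /= !SubK.
  exact: val_sub.
have [n [r [c [cE cr]]]] := finite_index_cosets gS hindex.
have cG := finitely_generated_countable hfg.
have [X [actX [[hX [d hd] hmp] hfree]]] := hL.
have hmpG := induced_mean_proximal gS cE cr hnormal cG hX hd hmp.
exists (power n X), (induced_act r c actX); split => //.
move=> mu hmu gmu nu hst g g1.
have hG := induced_Gspace cE cr hX.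
apply: (null_fixpoints hG (power_dist_metric n hd) hmu gmu hst cE _ hrad g1).
move=> h hS h1.
pose l : L := Sub h hS.
have hl : h = val l by rewrite SubK.
(* Any coordinate would do; [c 1] exhibits one. *)
pose i := c 1%g.
have tK := conj_subK r hnormal (L := L).
have tVK := conj_subVK r hnormal (L := L).
have tM := conj_subM r hnormal (L := L).
have stl := stationary_twisted gS cE cr hnormal hX hmu hst.
have stX := marginal_stationary tK tVK i stl.
have hmuL := return_law_prob hmu gS cE L.
have gmuL := return_law_generating hmu gS cE (L := L) gmu.
have l1 : conj_sub r i l <> 1%g.
  move=> e; apply: h1; rewrite hl -(tK i l) e /conj_subV val1L conj1g.
  by rewrite -(val1L L) to_subK ?val1L//; case: gS.
have F0 := hfree _ (twist_law_prob (tK i) (tVK i) hmuL)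
  (twist_law_generating (tK i) (tVK i) (@tM i) gmuL) _ stX _ l1.
apply/eqP; rewrite -measure_le0 -F0.
apply: (@le_measure _ _ _ nu); rewrite ?inE.
- exact: measurable_fixpoints hG (power_dist_metric n hd) h.
- rewrite -[X in measurable X]setTI; apply: measurable_power_proj => //.
  exact: measurable_fixpoints hX hd _.
- by move=> y; rewrite /fixpoints /= hl (induced_act_sub cE) // => {2}<-.
Qed.
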